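(* Let $X\dashrightarrow X_i^+$ be a simple flop of an irreducible curve $C_i\subset X$, with flopped curve $C_i^+\subset X_i^+$, lattice transformations $\mathsf M_i$, $\mathsf N_i$ and Novikov variables $q$ on $X$, $r$ on $X_i^+$. Put $$\kappa_i=\sum_{d\ge1}d^3\,n_{dC_i,X}.$$ After analytic continuation and the change of Novikov variables $q^\beta=r^{\mathsf M_i^{-1}\beta}$, for all divisor directions $\eta,\xi\in H^2(X_i^+)$, $$\mathscr H_{X_i^+}(\eta,\xi)-\mathscr H_X(\mathsf N_i\eta,\mathsf N_i\xi)\equiv\kappa_i\,(C_i^+\cdot\eta)(C_i^+\cdot\xi)\log r_i .$$ Hence the defect of covariance is supported on the flopped ray (only the classes $dC_i$, respectively $dC_i^+$, $d\ge1$, contribute to it), has rank one in the divisor variables, and is independent of $\lambda$. Moreover, for the renormalized forcings $$\widehat{\mathscr H}_{X,i}(\eta',\xi')=\mathscr H_X(\eta',\xi')-\frac{\kappa_i}{2}(C_i\cdot\eta')(C_i\cdot\xi')\log q_i\qquad(\eta',\xi'\in H^2(X)),$$ $$\widehat{\mathscr H}_{X_i^+,i}(\eta,\xi)=\mathscr H_{X_i^+}(\eta,\xi)-\frac{\kappa_i}{2}(C_i^+\cdot\eta)(C_i^+\cdot\xi)\log r_i\qquad(\eta,\xi\in H^2(X_i^+)),$$ one has exact flop covariance: $$\widehat{\mathscr H}_{X_i^+,i}(\eta,\xi)\equiv\widehat{\mathscr H}_{X,i}(\mathsf N_i\eta,\mathsf N_i\xi).$$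
   Context: **Potential and forcing.** $X$ is a smooth threefold with a flopping contraction, $A_1(X)$ is the lattice of (exceptional) curve classes, and $H^2(X)$ is the dual lattice of divisor classes, with intersection pairing $\beta\cdot\eta$. $n_{\beta,X}$ denotes the genus zero Gopakumar–Vafa (GV) invariant of $X$ in the effective curve class $\beta$; only finitely many are nonzero. With $q^\beta=e^{2\pi i(\beta\cdot t)}$, $$F_X(\lambda,t)=\sum_\beta n_{\beta,X}\sum_{k\ge1}\frac{q^{k\beta}}{k(2\sin(k\lambda/2))^2},$$ the sum being over effective classes. For $\eta\in H^2(X)$, $\nabla_\eta=T_{h\eta/2}-T_{-h\eta/2}$ with $h=\lambda/(2\pi)$, where $T_{\pm h\eta/2}$ acts coefficientwise by $q^\beta\mapsto e^{\pm i\lambda(\beta\cdot\eta)/2}q^\beta$. Set $\mathscr H_X(\eta,\xi)=\nabla_\eta\nabla_\xi F_X$, and similarly for $X_i^+$ with Novikov variables $r^\gamma$, $\gamma\in A_1(X_i^+)$. Write $q_i=q^{C_i}$, $r_i=r^{C_i^+}$. **Flop transformation (standard data, due to Nabijou–Wemyss, taken as given).** The flop induces a lattice isomorphism $\mathsf M_i:A_1(X_i^+)\to A_1(X)$ and its dual $\mathsf N_i=(\mathsf M_i^{-1})^\star:H^2(X_i^+)\to H^2(X)$, so that $\mathsf N_i\eta\cdot\beta=\eta\cdot\mathsf M_i^{-1}\beta$ for $\beta\in A_1(X)$. They satisfy $\mathsf M_i(C_i^+)=-C_i$. The GV invariants are reindexed off the flopped ray: $\gamma\mapsto\mathsf M_i\gamma$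 identifies the classes $\gamma\notin\mathbb Z_{>0}C_i^+$ with nonzero GV invariant on $X_i^+$ with the classes not in $\mathbb Z_{>0}C_i$ with nonzero GV invariant on $X$, and $n_{\gamma,X_i^+}=n_{\mathsf M_i\gamma,X}$; on the ray, $n_{dC_i^+,X_i^+}=n_{dC_i,X}$ for $d\ge1$. The Novikov variables are related by $q^\beta=r^{\mathsf M_i^{-1}\beta}$; in particular $q_i=r_i^{-1}$, and $\log q_i=-\log r_i$. **Conventions.** Analytic continuations are taken on a simply connected covering of the relevant complement of the pole arrangement. $A\equiv B$ means that $A-B$ is independent of all Novikov variables. *)

(* Defs.v *)
From mathcomp Require Import all_boot all_order all_algebra.
From mathcomp Require Import all_classical all_reals all_analysis.
From mathcomp Require Import complex.

Set Implicit Arguments.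
Unset Strict Implicit.
Unset Printing Implicit Defensive.

Import Order.TTheory GRing.Theory Num.Theory.
Import numFieldNormedType.Exports.

Local Open Scope classical_set_scope.
Local Open Scope ring_scope.

(* Packing [R[i]] as a numClosedFieldType makes the generic topology and norm
   of MathComp-Analysis available on it. *)
Definition Cx (R : realType) : numClosedFieldType := R[i]%C.

Definition cexp (R : realType) (z : Cx R) : Cx R :=
  (expR (complex.Re z) * cos (complex.Im z)
     +i* (expR (complex.Re z) * sin (complex.Im z)))%C.

Definition csin (R : realType) (z : Cx R) : Cx R :=
  (cexp ('i * z) - cexp (- ('i * z))) / (2 * 'i).

Definition twopii (R : realType) : Cx R := 2 * (pi%:C)%C * 'i.

(* Curve classes are the row vectors over [int], divisor classes are the column
   vectors (the dual lattice), and a point t of H^2 tensored with the complex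
   numbers is a column vector over [Cx R]. *)
Definition pairing n (beta : 'rV[int]_n) (eta : 'cV[int]_n) : int :=
  (beta *m eta) ord0 ord0.

Definition cpairing (R : realType) n (beta : 'rV[int]_n) (t : 'cV[Cx R]_n) :
    Cx R :=
  (map_mx intr beta *m t) ord0 ord0.

(* q^beta at t.  The coordinate t is a point of the universal cover of the
   Novikov torus, so that the logarithm of q^beta is a function of t. *)
Definition qvar (R : realType) n (t : 'cV[Cx R]_n) (beta : 'rV[int]_n) : Cx R :=
  cexp (twopii R * cpairing beta t).

Definition logq (R : realType) n (t : 'cV[Cx R]_n) (beta : 'rV[int]_n) : Cx R :=
  twopii R * cpairing beta t.

(* The numerical data carried by a threefold with a flopping contraction: the
   semigroup of nonzero effective classes, which lies strictly on one side of a
   relatively ample class, and the genus zero GV invariants, extended by zero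
   to the classes that are not effective. *)
Record gv_threefold (n : nat) := GVThreefold {
  eff : set 'rV[int]_n;
  effD : forall b c, eff b -> eff c -> eff (b + c);
  eff_ample : exists A : 'cV[int]_n, forall b, eff b -> 0 < pairing b A;
  gv : 'rV[int]_n -> int;
  gv_eff : forall b, gv b != 0 -> eff b;
  gv_finite : finite_set [set b | gv b != 0]
}.

Definition ray n (C : 'rV[int]_n) : set 'rV[int]_n :=
  [set b | exists2 d : nat, (0 < d)%N & b = C *+ d].

(* The lattice isomorphism M from the curve classes of X+ to those of X acts on
   row vectors by [gamma |-> gamma *m fM]. *)
Record simple_flop n (X Xp : gv_threefold n) := SimpleFlop {
  fC : 'rV[int]_n;
  fCp : 'rV[int]_n;
  fC_eff : eff X fC;
  fCp_eff : eff Xp fCp;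
  fM : 'M[int]_n;
  fM_unit : fM \in unitmx;
  fM_curve : fCp *m fM = - fC;
  fgv_off : forall c, gv Xp c != 0 -> ~ ray fCp c ->
    ~ ray fC (c *m fM) /\ gv Xp c = gv X (c *m fM);
  fgv_off_surj : forall b, gv X b != 0 -> ~ ray fC b ->
    exists c, [/\ gv Xp c != 0, ~ ray fCp c & c *m fM = b];
  fgv_ray : forall d : nat, (0 < d)%N -> gv Xp (fCp *+ d) = gv X (fC *+ d)
}.

(* N is the dual of the inverse of M:
   pairing b (flopN phi eta) = pairing (b *m invmx (fM phi)) eta. *)
Definition flopN n (X Xp : gv_threefold n) (phi : simple_flop X Xp)
    (eta : 'cV[int]_n) : 'cV[int]_n :=
  invmx (fM phi) *m eta.

(* The coordinate on X+ of the point with coordinate t on X, so that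
   qvar (flop_coord phi t) c = qvar t (c *m fM phi). *)
Definition flop_coord (R : realType) n (X Xp : gv_threefold n)
    (phi : simple_flop X Xp) (t : 'cV[Cx R]_n) : 'cV[Cx R]_n :=
  map_mx intr (fM phi) *m t.

(* The sums over beta and over d are finitely supported. *)
Definition kappa n (X : gv_threefold n) (C : 'rV[int]_n) : int :=
  \sum_(d \in [set d : nat | (0 < d)%N]) (d ^ 3)%:Z * gv X (C *+ d).

(* [c beta k], for k positive, is the coefficient of q^(k beta) in the multiple
   cover series of the class beta. *)
Definition novikov_series (R : realType) n := 'rV[int]_n -> nat -> Cx R.

Definition potential (R : realType) n (X : gv_threefold n) (lambda : Cx R) :
    novikov_series R n :=
  fun beta k =>
    (gv X beta)%:~R / (k%:R * (2 * csin (k%:R * lambda / 2)) ^+ 2).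

(* T_(h eta / 2); T_(- h eta / 2) is the operator of - eta. *)
Definition half_translation (R : realType) n (lambda : Cx R)
    (eta : 'cV[int]_n) (c : novikov_series R n) : novikov_series R n :=
  fun beta k =>
    cexp ('i * lambda * (pairing (beta *+ k) eta)%:~R / 2) * c beta k.

Definition nabla (R : realType) n (lambda : Cx R) (eta : 'cV[int]_n)
    (c : novikov_series R n) : novikov_series R n :=
  fun beta k =>
    half_translation lambda eta c beta k
      - half_translation lambda (- eta) c beta k.

Definition class_sum (R : realType) n (c : novikov_series R n)
    (beta : 'rV[int]_n) (t : 'cV[Cx R]_n) : Cx R :=
  limn (series (fun k : nat => c beta k.+1 * qvar t (beta *+ k.+1))).

Definition class_forcing (R : realType) n (X : gv_threefold n) (lambda : Cx R)
    (eta xi : 'cV[int]_n) (beta : 'rV[int]_n) (t : 'cV[Cx R]_n) : Cx R :=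
  class_sum (nabla lambda eta (nabla lambda xi (potential X lambda))) beta t.

Definition forcing (R : realType) n (X : gv_threefold n) (lambda : Cx R)
    (eta xi : 'cV[int]_n) (t : 'cV[Cx R]_n) : Cx R :=
  \sum_(beta \in eff X) class_forcing X lambda eta xi beta t.

(* The denominators of the potential do not vanish. *)
Definition generic (R : realType) (lambda : Cx R) : Prop :=
  forall k : nat, (0 < k)%N -> csin (k%:R * lambda / 2) != 0.

(* With a = pairing beta eta and b = pairing beta xi, the quotient
   sin(k lambda a/2) sin(k lambda b/2) / sin(k lambda/2)^2 is, up to sign, the
   sum over j < |a| and l < |b| of the k-th powers of these phases.  Hence the
   contribution of beta is a sum of logarithms of 1 - phase * q^beta. *)
Definition phase (R : realType) (lambda : Cx R) (a b : int) (j l : nat) : Cx R :=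
  cexp ('i * lambda * ((`|a| + `|b|)%N%:R / 2 - (j + l + 1)%N%:R)).

Definition pole_locus (R : realType) n (X : gv_threefold n) (lambda : Cx R)
    (eta xi : 'cV[int]_n) : set 'cV[Cx R]_n :=
  [set t | exists beta, gv X beta != 0 /\
    exists j l : nat, [/\ (j < `|pairing beta eta|)%N,
      (l < `|pairing beta xi|)%N &
      phase lambda (pairing beta eta) (pairing beta xi) j l * qvar t beta = 1]].

(* The region on which the series of the forcing converge. For real lambda it
   is given by |q^beta| < 1 for the classes that contribute. *)
Definition large_volume (R : realType) n (X : gv_threefold n) (lambda : Cx R)
    (eta xi : 'cV[int]_n) : set 'cV[Cx R]_n :=
  [set t | forall beta, gv X beta != 0 ->
    forall j l : nat, (j < `|pairing beta eta|)%N ->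
      (l < `|pairing beta xi|)%N ->
      `|phase lambda (pairing beta eta) (pairing beta xi) j l * qvar t beta| < 1].

Definition flop_complement (R : realType) n (X Xp : gv_threefold n)
    (phi : simple_flop X Xp) (lambda : Cx R) (eta xi : 'cV[int]_n) :
    set 'cV[Cx R]_n :=
  ~` (pole_locus X lambda (flopN phi eta) (flopN phi xi) `|`
      (flop_coord phi @^-1` pole_locus Xp lambda eta xi)).

(* [sigma i], for i : I, are the sections over V whose images are the sheets. *)
Definition covering (S T : topologicalType) (p : S -> T) (U : set T) : Prop :=
  [/\ continuous p, range p = U &
    forall x, U x -> exists V : set T, [/\ open V, V x, V `<=` U &
      exists (I : Type) (sigma : I -> T -> S),
        [/\ forall i y, V y -> p (sigma i y) = y,
            forall i, {within V, continuous (sigma i)},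
            forall i, open (sigma i @` V) &
            forall s, V (p s) -> exists! i, sigma i (p s) = s]]].

Definition path_connected (R : realType) (S : topologicalType) : Prop :=
  forall x y : S, exists f : R -> S,
    [/\ {within `[0, 1], continuous f}, f 0 = x & f 1 = y].

Definition simply_connected (R : realType) (S : topologicalType) : Prop :=
  path_connected R S /\
  forall f : R -> S, {within `[0, 1], continuous f} -> f 0 = f 1 ->
    exists H : R * R -> S,
      [/\ {within `[0, 1] `*` `[0, 1], continuous H},
          forall x, x \in `[0, 1] -> H (0, x) = f x,
          forall x, x \in `[0, 1] -> H (1, x) = f 0 &
          forall y, y \in `[0, 1] -> H (y, 0) = f 0 /\ H (y, 1) = f 0].

(* Differentiability over [Cx R] is complex differentiability. *)
Definition holomorphic_over (R : realType) n (S : topologicalType)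
    (p : S -> 'cV[Cx R]_n) (f : S -> Cx R) : Prop :=
  forall s, exists F : 'cV[Cx R]_n -> Cx R,
    (\forall t \near p s, differentiable F t) /\
    (\forall s' \near s, f s' = F (p s')).

(* On a connected S there is at most one such f, by the identity theorem. *)
Definition continuation (R : realType) n (S : topologicalType)
    (p : S -> 'cV[Cx R]_n) (s0 : S) (h : 'cV[Cx R]_n -> Cx R) (f : S -> Cx R) :
    Prop :=
  holomorphic_over p f /\ (\forall s \near s0, f s = h (p s)).

Definition novikov_equiv (R : realType) (S : Type) (f g : S -> Cx R) : Prop :=
  exists c : Cx R, forall s, f s - g s = c.

Definition renormalize (R : realType) n (k : int) (C : 'rV[int]_n)
    (eta xi : 'cV[int]_n) (t : 'cV[Cx R]_n) (h : Cx R) : Cx R :=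
  h - k%:~R / 2 * (pairing C eta)%:~R * (pairing C xi)%:~R * logq t C.

(* Main.v *)
Require Import Defs.
From mathcomp Require Import all_boot all_order all_algebra.
From mathcomp Require Import all_classical all_reals all_analysis.
From mathcomp Require Import complex ring lra.

Set Implicit Arguments.
Unset Strict Implicit.
Unset Printing Implicit Defensive.

Import Order.TTheory GRing.Theory Num.Theory.
Import numFieldNormedType.Exports.

Local Open Scope classical_set_scope.
Local Open Scope ring_scope.

(** The difference operators turn the genus zero potential into a sum of
    logarithms. For a class [beta] with [a = beta . eta] and [a' = beta . xi],
    the quotient of each translation difference by [2 sin (k lambda / 2)] is a
    geometric sum up to a power of [i], so the series over multiple covers of [beta] is
    [n_beta sgn a sgn a' sum_(j < |a|, l < |a'|) log (1 - z_jl q^beta)], where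
    the [z_jl] are the phases ([class_forcingE]). Its continuation is
    therefore a matter of choosing a continuous logarithm of each factor
    [1 - z_jl q^beta] on the covering, where none of them vanishes.

    Such logarithms exist because the covering space is simply connected
    ([log_lift]). Along a path one subdivides finely and adds principal
    logarithms of the successive ratios; over a square, with a subdivision
    uniform in the second parameter, the same construction ([log_ratio]) shows
    that the logarithm along a null-homotopic loop returns to its initial value
    ([loop_log]). Locally the lift is a constant plus the principal logarithm of
    a holomorphic function, hence holomorphic. The principal logarithm is given
    explicitly on the right half plane, and its power series is compared with
    it by the mean value theorem ([clog_series_bound]), which yields
    convergence and complex differentiability together.

    The same branches serve [X] and its flop; the two normalizations, at a
    point of large volume of each, only change additive constants. Off the ray
    the lattice isomorphism matches invariants, pairings and monomials, so the
    contributions agree up to a constant. The class [d Cp] corresponds to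
    [- d C], which inverts the monomial [z = r^(d Cp)]. The phases are stable
    under inversion ([phase_rev]), and [1 - z = - z (1 - z^-1)]
    ([log_branch_inv]), so each of the [|a| |a'|] factors contributes one
    [log z = d log r] ([branch_sum_ray]). As [sgn a |a| = d (Cp . eta)], the
    class contributes [n_d d^3 (Cp . eta) (Cp . xi) log r], and the sum over
    [d] gives the coefficient [kappa]. The renormalized statement follows since
    [log q = - log r] and [C . N eta = - Cp . eta]. *)

(** * Complex numbers and the exponential *)

Section ComplexNumbers.
Variable R : realType.
Implicit Types (x y t : R) (z w h : Cx R).

Lemma Cx_eq z w :
  complex.Re z = complex.Re w -> complex.Im z = complex.Im w -> z = w.
Proof. by case: z w => [a b] [c d] /= -> ->. Qed.

Lemma ReD z w : complex.Re (z + w) = complex.Re z + complex.Re w.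
Proof. by case: z w => [a b] [c d]. Qed.

Lemma ImD z w : complex.Im (z + w) = complex.Im z + complex.Im w.
Proof. by case: z w => [a b] [c d]. Qed.

Lemma ReN z : complex.Re (- z) = - complex.Re z.
Proof. by case: z. Qed.

Lemma ImN z : complex.Im (- z) = - complex.Im z.
Proof. by case: z. Qed.

Lemma ReM z w : complex.Re (z * w) =
  complex.Re z * complex.Re w - complex.Im z * complex.Im w.
Proof. by case: z w => [a b] [c d]. Qed.

Lemma ImM z w : complex.Im (z * w) =
  complex.Re z * complex.Im w + complex.Im z * complex.Re w.
Proof. by case: z w => [a b] [c d]. Qed.

Lemma ReV z : complex.Re z^-1 =
  complex.Re z / (complex.Re z ^+ 2 + complex.Im z ^+ 2).
Proof. by case: z. Qed.

Lemma ImV z : complex.Im z^-1 =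
  - complex.Im z / (complex.Re z ^+ 2 + complex.Im z ^+ 2).
Proof. by case: z => a b /=; rewrite mulNr. Qed.

Lemma natV_Cx n : (n%:R : Cx R)^-1 = ((n%:R^-1)%:C)%C.
Proof. by rewrite -(rmorph_nat (real_complex R)) -fmorphV. Qed.

Lemma Re_divn z n : complex.Re (z / n%:R) = complex.Re z / n%:R.
Proof. by rewrite natV_Cx ReM /= mulr0 subr0. Qed.

Lemma Im_divn z n : complex.Im (z / n%:R) = complex.Im z / n%:R.
Proof. by rewrite natV_Cx ImM /= mulr0 add0r. Qed.

Lemma Re_sum (I : Type) (r : seq I) (F : I -> Cx R) :
  complex.Re (\sum_(i <- r) F i) = \sum_(i <- r) complex.Re (F i).
Proof. by apply: (big_morph _ ReD). Qed.

Lemma Im_sum (I : Type) (r : seq I) (F : I -> Cx R) :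
  complex.Im (\sum_(i <- r) F i) = \sum_(i <- r) complex.Im (F i).
Proof. by apply: (big_morph _ ImD). Qed.

(** The absolute value as an element of [R], so that the tactics for ordered fields
    apply to estimates. *)
Definition modc z : R := complex.Re `|z|.

Lemma modcE z : `|z| = ((modc z)%:C)%C :> Cx R.
Proof. by rewrite /modc normc_def. Qed.

Lemma modc_sqrt z :
  modc z = Num.sqrt (complex.Re z ^+ 2 + complex.Im z ^+ 2).
Proof. by rewrite /modc normc_def. Qed.

Lemma modc_ge0 z : 0 <= modc z.
Proof. by rewrite modc_sqrt sqrtr_ge0. Qed.

Lemma modcM z w : modc (z * w) = modc z * modc w.
Proof.
by apply: (@complexI R); rewrite -modcE normrM !modcE -rmorphM.
Qed.

Lemma modcD z w : modc (z + w) <= modc z + modc w.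
Proof.
by rewrite -lecR raddfD /= -!modcE; exact: ler_normD.
Qed.

Lemma modcN z : modc (- z) = modc z.
Proof. by rewrite /modc normrN. Qed.

Lemma modc1 : modc 1 = 1.
Proof. by rewrite /modc normr1. Qed.

Lemma modcV z : modc z^-1 = (modc z)^-1.
Proof. by apply: (@complexI R); rewrite -modcE normfV modcE fmorphV. Qed.

Lemma modcX z k : modc (z ^+ k) = modc z ^+ k.
Proof. by elim: k => [|k IH]; rewrite ?expr0 ?modc1// !exprS modcM IH. Qed.

Lemma modc_gt0 z : (0 < modc z) = (z != 0).
Proof. by rewrite -ltcR -modcE; exact: normr_gt0. Qed.

Lemma Re_le_modc z : `|complex.Re z| <= modc z.
Proof.
by rewrite modc_sqrt -sqrtr_sqr ler_wsqrtr// lerDl sqr_ge0.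
Qed.

Lemma Im_le_modc z : `|complex.Im z| <= modc z.
Proof.
by rewrite modc_sqrt -sqrtr_sqr ler_wsqrtr// lerDr sqr_ge0.
Qed.

Lemma modc_le z : modc z <= `|complex.Re z| + `|complex.Im z|.
Proof.
rewrite modc_sqrt -[leRHS]ger0_norm ?addr_ge0// -[leRHS]sqrtr_sqr ler_wsqrtr//.
rewrite sqrrD !real_normK ?num_real// lerD2r lerDl.
by rewrite mulrn_wge0// mulr_ge0.
Qed.

Lemma Cx_gt0 (e : Cx R) : 0 < e -> exists2 d : R, 0 < d & e = (d%:C)%C.
Proof.
by case: e => a b; rewrite ltcE /= => /andP[/eqP -> a0]; exists a.
Qed.

Lemma modc_lt z (d : R) : (`|z| < (d%:C)%C) = (modc z < d).
Proof. by rewrite modcE ltcR. Qed.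

Lemma cvg_Cx (T : Type) (F : set_system T) (FF : Filter F) (f : T -> Cx R)
    (l : Cx R) :
  complex.Re (f x) @[x --> F] --> complex.Re l ->
  complex.Im (f x) @[x --> F] --> complex.Im l -> f x @[x --> F] --> l.
Proof.
move=> /cvgrPdist_lt hr /cvgrPdist_lt hi.
apply/cvgrPdist_lt => e /Cx_gt0[d d0 ->].
have d20 : 0 < d / 2 by rewrite divr_gt0.
near=> x; rewrite modc_lt (le_lt_trans (modc_le _))// ReD ImD ReN ImN.
by rewrite [ltRHS]splitr ltrD//; near: x; [exact: hr|exact: hi].
Unshelve. all: by end_near. Qed.

Lemma cvg_modc (T : Type) (F : set_system T) (FF : Filter F) (f : T -> Cx R)
    (l : Cx R) :
  modc (f x - l) @[x --> F] --> 0 -> f x @[x --> F] --> l.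
Proof.
move=> /cvgrPdist_lt h; apply/cvgrPdist_lt => e /Cx_gt0[d d0 ->].
near=> x; rewrite modc_lt -modcN opprB.
have : `|0 - modc (f x - l)| < d by near: x; exact: h.
by rewrite sub0r normrN ger0_norm// modc_ge0.
Unshelve. all: by end_near. Qed.

Lemma near_modc (T : Type) (F : set_system T) (FF : Filter F) (f : T -> Cx R)
    (l : Cx R) (d : R) : f x @[x --> F] --> l -> 0 < d ->
  \forall x \near F, modc (f x - l) < d.
Proof.
move=> /cvgrPdist_lt h d0; near=> x; rewrite -modcN opprB -modc_lt.
by near: x; apply: h; rewrite ltcR.
Unshelve. all: by end_near. Qed.

Lemma cvg_Re (T : Type) (F : set_system T) (FF : Filter F) (f : T -> Cx R)
    (l : Cx R) :
  f x @[x --> F] --> l -> complex.Re (f x) @[x --> F] --> complex.Re l.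
Proof.
move=> h; apply/cvgrPdist_lt => d d0; near=> x.
rewrite -ReN -ReD (le_lt_trans (Re_le_modc _))// -modcN opprB.
by near: x; exact: near_modc.
Unshelve. all: by end_near. Qed.

Lemma cvg_Im (T : Type) (F : set_system T) (FF : Filter F) (f : T -> Cx R)
    (l : Cx R) :
  f x @[x --> F] --> l -> complex.Im (f x) @[x --> F] --> complex.Im l.
Proof.
move=> h; apply/cvgrPdist_lt => d d0; near=> x.
rewrite -ImN -ImD (le_lt_trans (Im_le_modc _))// -modcN opprB.
by near: x; exact: near_modc.
Unshelve. all: by end_near. Qed.

Lemma real_complex_continuous : continuous (fun t : R => (t%:C)%C : Cx R).
Proof. by move=> t; apply: cvg_Cx => /=; [exact: cvg_id|exact: cvg_cst]. Qed.

Lemma cexpD z w : cexp (z + w) = cexp z * cexp w.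
Proof.
apply: Cx_eq; rewrite ?ReM ?ImM /= ReD ImD expRD ?cosD ?sinD; ring.
Qed.

Lemma cexp0 : cexp (0 : Cx R) = 1.
Proof. by rewrite /cexp /= expR0 cos0 sin0 !mul1r. Qed.

Lemma cexp_neq0 z : cexp z != 0.
Proof.
apply/eqP => h; have := cexpD z (- z); rewrite h subrr cexp0 mul0r.
by move/eqP; rewrite oner_eq0.
Qed.

Lemma cexpN z : cexp (- z) = (cexp z)^-1.
Proof.
by apply: (mulfI (cexp_neq0 z)); rewrite -cexpD subrr cexp0 mulfV// cexp_neq0.
Qed.

Lemma cexpB z w : cexp (z - w) = cexp z / cexp w.
Proof. by rewrite cexpD cexpN. Qed.

Lemma cexpMn z k : cexp (k%:R * z) = cexp z ^+ k.
Proof.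
elim: k => [|k IH]; first by rewrite mul0r cexp0.
by rewrite -natr1 mulrDl mul1r cexpD IH exprSr.
Qed.

Lemma modc_cexp z : modc (cexp z) = expR (complex.Re z).
Proof.
rewrite modc_sqrt /= !exprMn -mulrDr cos2Dsin2 mulr1 sqrtr_sqr ger0_norm//.
Qed.

(** Two logarithms of the same number coincide once their imaginary parts are
    known to differ by less than the period. *)
Lemma cexp_eq1 z : cexp z = 1 -> `|complex.Im z| < 2 * pi -> z = 0.
Proof.
move=> h him; have hr : complex.Re z = 0.
  by apply: (@expR_inj R); rewrite expR0 -modc_cexp h modc1.
apply: Cx_eq => //=; have := congr1 (@complex.Re R) h.
rewrite /= hr expR0 mul1r => hc.
have s0 : sin (complex.Im z / 2) = 0.
  have : cos (complex.Im z / 2 *+ 2) = 1 by rewrite -mulr_natr divfK.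
  by rewrite cos_mulr2n cos2sin2 => h1; apply/eqP; rewrite -sqrf_eq0; apply/eqP; lra.
have [//|] := eqVneq (complex.Im z) 0.
have /andP[l1 l2] : - (2 * pi) < complex.Im z < 2 * pi by rewrite -ltr_norml.
rewrite neq_lt => /orP[n|p].
  have : 0 < sin (- (complex.Im z / 2)) by apply: sin_gt0_pi; apply/andP; lra.
  by rewrite sinN s0 oppr0 ltxx.
have : 0 < sin (complex.Im z / 2) by apply: sin_gt0_pi; apply/andP; lra.
by rewrite s0 ltxx.
Qed.

Lemma abs_sin_le y : `|sin y| <= `|y|.
Proof.
wlog y0 : y / 0 <= y => [hw|].
  have [|/ltW y0] := leP 0 y; first exact: hw.
  by have := hw (- y); rewrite sinN !normrN; apply; rewrite oppr_ge0.
have [c _ /=] := @MVT_segment R sin cos 0 y y0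
  (fun x _ => is_derive_sin x) (continuous_subspaceT (@continuous_sin R)).
rewrite sin0 !subr0 => ->; rewrite normrM ler_piMl//; exact: cos_max.
Qed.

Lemma abs_cos1_le y : `|cos y - 1| <= y ^+ 2.
Proof.
have -> : cos y - 1 = - (sin (y / 2) ^+ 2 *+ 2).
  have := cos_mulr2n (y / 2); rewrite -[y / 2 *+ 2]mulr_natr divfK//.
  by move=> ->; rewrite cos2sin2 !mulr2n; ring.
rewrite normrN ger0_norm ?mulrn_wge0 ?sqr_ge0//.
have := abs_sin_le (y / 2); rewrite -(@ler_pXn2r _ 2)// ?nnegrE//.
rewrite !real_normK ?num_real// mulr2n.
have -> : (y / 2) ^+ 2 = y ^+ 2 / 4 by field.
move=> h; have := sqr_ge0 y; lra.
Qed.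

Lemma abs_sinB_le y : `|y| <= 1 -> `|sin y - y| <= y ^+ 2.
Proof.
wlog y0 : y / 0 <= y => [hw h1|].
  have [|/ltW y0] := leP 0 y; first by move=> y0; apply: hw.
  have := hw (- y); rewrite sinN -opprD !normrN sqrrN; apply => //.
  by rewrite oppr_ge0.
rewrite ger0_norm// => y1.
have dsin (x : R) : x \in `]0, y[ ->
    is_derive x 1 (fun y => sin y - y) (cos x - 1).
  by move=> _; apply: is_derive_eq.
have csinB : {within `[0, y], continuous (fun y => sin y - y)}.
  apply: continuous_subspaceT => x.
  by apply: cvgB; [exact: continuous_sin|exact: cvg_id].
have [c] := MVT_segment y0 dsin csinB.
rewrite in_itv /= sin0 !subr0 => /andP[c0 cy] ->.
rewrite normrM (ger0_norm y0) expr2 ler_wpM2r//.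
rewrite (le_trans (abs_cos1_le _))// expr2 -[leRHS]mul1r ler_pM//.
exact: le_trans cy y1.
Qed.

Lemma expRB1_le x : `|x| <= 1 / 2 -> `|expR x - 1 - x| <= 2 * x ^+ 2.
Proof.
move=> hx; have /andP[x1 x2] : - (1 / 2) <= x <= 1 / 2 by rewrite -ler_norml.
have h1 := expR_ge1Dx x; have h2 := expR_ge1Dx (- x).
have hp := expR_gt0 x; have : expR x * expR (- x) = 1 by rewrite expRxMexpNx_1.
rewrite ger0_norm; last by lra.
by move=> h; nra.
Qed.

Lemma cexpB1_le h : modc h <= 1 / 2 ->
  modc (cexp h - 1 - h) <= 8 * modc h ^+ 2.
Proof.
move=> hh; have hr := Re_le_modc h; have hi := Im_le_modc h.
have e1 := expRB1_le (le_trans hr hh).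
have e2 := abs_cos1_le (complex.Im h).
have e3 : `|sin (complex.Im h) - complex.Im h| <= complex.Im h ^+ 2.
  by apply: abs_sinB_le; lra.
have e4 := abs_sin_le (complex.Im h).
apply: le_trans (modc_le _) _; rewrite !ReD !ImD !ReN !ImN /= subr0.
move: (complex.Re h) (complex.Im h) (modc h) (modc_ge0 h) hh hr hi e1 e2 e3 e4.
move=> x y m m0 hm hx hy.
have x2 : x ^+ 2 <= m ^+ 2.
  by rewrite -real_normK ?num_real// ler_pXn2r// nnegrE.
have y2 : y ^+ 2 <= m ^+ 2.
  by rewrite -real_normK ?num_real// ler_pXn2r// nnegrE.
move=> e1 e2 e3 e4.
have ex : `|expR x - 1| <= 2 * m.
  have -> : expR x - 1 = (expR x - 1 - x) + x by ring.
  apply: le_trans (ler_normD _ _) _; nra.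
have ex2 : `|expR x| <= 2.
  have -> : expR x = (expR x - 1) + 1 by ring.
  apply: le_trans (ler_normD _ _) _; rewrite normr1; lra.
have -> : expR x * cos y - 1 - x = expR x * (cos y - 1) + (expR x - 1 - x).
  by ring.
have -> : expR x * sin y - y = (expR x - 1) * sin y + (sin y - y) by ring.
apply: le_trans (lerD (ler_normD _ _) (ler_normD _ _)) _; rewrite !normrM.
have p1 : `|expR x| * `|cos y - 1| <= 2 * m ^+ 2.
  by rewrite ler_pM// (le_trans e2).
have p2 : `|expR x - 1| * `|sin y| <= 2 * m * m.
  by rewrite ler_pM// (le_trans e4).
have p3 : `|expR x - 1 - x| <= 2 * m ^+ 2 by apply: le_trans e1 _; lra.
have p4 : `|sin y - y| <= 2 * m ^+ 2.
  by apply: le_trans e3 _; have := sqr_ge0 m; lra.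
have -> : 8 * m ^+ 2 = 2 * m ^+ 2 + 2 * m ^+ 2 + (2 * m * m + 2 * m ^+ 2).
  by ring.
by rewrite lerD// lerD.
Qed.

(** Complex differentiability is obtained from explicit remainders, for [cexp]
    at every point and for the logarithm on the right half plane. *)
Lemma quadratic_differentiable (f : Cx R -> Cx R) (a c : Cx R) (K r : R) :
  0 < r -> (forall h, modc h < r ->
    modc (f (a + h) - f a - c * h) <= K * modc h ^+ 2) ->
  differentiable f a.
Proof.
move=> r0 hf; apply/derivable1_diffP; apply/cvg_ex; exists c => /=.
apply: (@cvg_modc _ _ (dnbhs_filter (0 : Cx R))).
apply/cvgrPdist_lt => d d0; near=> h.
rewrite sub0r normrN ger0_norm ?modc_ge0//.
have h0 : h != 0 by near: h; exact: nbhs_dnbhs_neq.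
have hm : modc h < Num.min r (d / (`|K| + 1)).
  rewrite -[h]subr0; near: h; apply: (near_modc (dnbhs_filter _)).
    exact: nbhs_dnbhs.
  by rewrite lt_min r0 divr_gt0// ltr_wpDl.
move: hm; rewrite lt_min => /andP[hr hd].
have -> : h^-1 *: (f (h *: 1 + a) - f a) - c = h^-1 * (f (a + h) - f a - c * h).
  by rewrite [h *: 1]mulr1 (addrC h) /GRing.scale /= !mulrBr (mulrC c) mulKf.
have hp : 0 < modc h by rewrite modc_gt0.
rewrite modcM modcV mulrC ltr_pdivrMr//.
apply: le_lt_trans (hf _ hr) _; rewrite expr2 mulrA ltr_pM2r//.
apply: le_lt_trans (_ : (`|K| + 1) * modc h < _).
  by rewrite ler_wpM2r// ?modc_ge0// (le_trans (ler_norm _))// lerDl.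
by rewrite -ltr_pdivlMl ?ltr_wpDl// mulrC.
Unshelve. all: by end_near. Qed.

Lemma cexp_differentiable z : differentiable (@cexp R) z.
Proof.
apply: (@quadratic_differentiable _ _ (cexp z) (modc (cexp z) * 8) (1 / 2)).
  by rewrite divr_gt0.
move=> h hh; rewrite cexpD.
have -> : cexp z * cexp h - cexp z - cexp z * h = cexp z * (cexp h - 1 - h).
  by rewrite !mulrBr mulr1.
by rewrite modcM -mulrA ler_wpM2l ?modc_ge0// cexpB1_le// ltW.
Qed.

End ComplexNumbers.

(** * The principal logarithm and its power series *)

Section PrincipalLogarithm.
Variable R : realType.
Implicit Types (x y t : R) (z w h : Cx R).

(** The arctangent of the slope is the argument on the right half plane, which
    contains every [1 - z] with [|z| < 1] and the ratios of close nonzero values. *)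
Definition clog w : Cx R :=
  (ln (complex.Re w ^+ 2 + complex.Im w ^+ 2) / 2
     +i* atan (complex.Im w / complex.Re w))%C.

Lemma clogK w : 0 < complex.Re w -> cexp (clog w) = w.
Proof.
case: w => x y /= x0; rewrite /cexp /=.
have D0 : 0 < x ^+ 2 + y ^+ 2 by rewrite ltr_wpDr ?sqr_ge0// exprn_gt0.
set r := expR (ln (x ^+ 2 + y ^+ 2) / 2).
have r0 : 0 < r by exact: expR_gt0.
have r2 : r ^+ 2 = x ^+ 2 + y ^+ 2.
  by rewrite expr2 -expRD -splitr lnK// posrE.
have hc : cos (atan (y / x)) = x / r.
  rewrite cos_atan; have -> : 1 + (y / x) ^+ 2 = (r / x) ^+ 2.
    by rewrite !expr_div_n r2; field; rewrite gt_eqF.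
  by rewrite sqrtr_sqr ger0_norm ?invf_div// divr_ge0// ltW.
have hs : sin (atan (y / x)) = y / r.
  have c0 : cos (atan (y / x)) != 0 by rewrite hc mulf_neq0 ?invr_neq0 ?gt_eqF.
  have := @atanK R (y / x); rewrite /tan => h.
  rewrite -(divfK c0 (sin _)) h hc.
  by field; rewrite !gt_eqF.
by congr (_ +i* _)%C; rewrite ?hc ?hs mulrC divfK ?gt_eqF.
Qed.

Lemma Im_clog w : `|complex.Im (clog w)| < pi / 2.
Proof. by rewrite ltr_norml /= atan_ltpi2 atan_gtNpi2. Qed.

Lemma clog1 : clog 1 = 0.
Proof. by rewrite /clog /= expr1n expr0n addr0 ln1 !mul0r atan0. Qed.

(** Both sides have the same exponential, and three arguments of modulus below
    [pi / 2] cannot add up to a period. *)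
Lemma clogM w w' : 0 < complex.Re w -> 0 < complex.Re w' ->
  0 < complex.Re (w * w') -> clog (w * w') = clog w + clog w'.
Proof.
move=> h h' hh; apply/eqP; rewrite -subr_eq0; apply/eqP.
have wn0 u : 0 < complex.Re u -> u != 0.
  by move=> u0; apply: contraTneq u0 => ->; rewrite ltxx.
apply: cexp_eq1.
  by rewrite cexpB cexpD !clogK// divff// mulf_neq0// wn0.
have := Im_clog w; have := Im_clog w'; have := Im_clog (w * w').
have := pi_gt0 R; rewrite ImD ImN ImD !ltr_norml; lra.
Qed.

Lemma cvg_clog (T : Type) (F : set_system T) (FF : Filter F) (f : T -> Cx R)
    (w : Cx R) : 0 < complex.Re w ->
  f x @[x --> F] --> w -> clog (f x) @[x --> F] --> clog w.
Proof.
move=> w0 h; have hr := cvg_Re FF h; have hi := cvg_Im FF h.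
have hd : complex.Re (f x) ^+ 2 + complex.Im (f x) ^+ 2 @[x --> F] -->
    complex.Re w ^+ 2 + complex.Im w ^+ 2.
  by apply: cvgD; apply: cvgM.
have hq : complex.Im (f x) / complex.Re (f x) @[x --> F] -->
    complex.Im w / complex.Re w.
  by apply: cvgM => //; apply: cvgV => //; rewrite gt_eqF.
apply: cvg_Cx => /=.
  apply: cvgMr_tmp; apply: (cvg_comp _ _ hd); apply: continuous_ln.
  by rewrite ltr_wpDr ?sqr_ge0// exprn_gt0.
by apply: (cvg_comp _ _ hq); exact: continuous_atan.
Qed.

Section Series.
Variables (x y : R).
Let z : Cx R := (x +i* y)%C.
Let den t := (1 - t * x) ^+ 2 + (t * y) ^+ 2.

Lemma is_derive_power_sum (c : nat -> R) N t :
  is_derive t 1 (fun t => \sum_(k < N) t ^+ k.+1 * (c k / k.+1%:R))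
    (\sum_(k < N) t ^+ k * c k).
Proof.
have -> : (fun t => \sum_(k < N) t ^+ k.+1 * (c k / k.+1%:R)) =
    \sum_(k < N) (fun t : R => t ^+ k.+1 * (c k / k.+1%:R)).
  by apply/funext => u; rewrite fct_sumE.
apply: is_derive_sum => k.
have -> : (fun t : R => t ^+ k.+1 * (c k / k.+1%:R)) =
    (c k / k.+1%:R) \*: (id ^+ k.+1 : R -> R).
  by apply/funext => u; rewrite /= mulrC exprfctE.
apply: is_derive_eq; rewrite /GRing.scale /= mulr1.
by rewrite mulrA divfK ?pnatr_eq0// mulrC.
Qed.

(** The left-hand side is the derivative in [t] of
    [log (1 - t z) + sum_(1 <= k <= N) (t z)^k / k]. *)
Lemma geometric_remainder N t : den t != 0 ->
  - z / (1 - (t%:C)%C * z) + \sum_(k < N) (t%:C)%C ^+ k * z ^+ k.+1 =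
  - z * ((t%:C)%C * z) ^+ N / (1 - (t%:C)%C * z) :> Cx R.
Proof.
move=> dt; have n0 : 1 - (t%:C)%C * z != 0 :> Cx R.
  apply: contraNneq dt => h; have h1 := congr1 (@complex.Re R) h.
  have h2 := congr1 (@complex.Im R) h.
  move: h1 h2; rewrite ReD ImD ReN ImN ReM ImM /= !mul0r subr0 addr0 add0r.
  by rewrite /den => -> /eqP; rewrite oppr_eq0 => /eqP ->; rewrite expr0n addr0.
apply: (mulIf n0); rewrite mulrDl !divfK//.
elim: N => [|N IH]; first by rewrite big_ord0 mul0r addr0 expr0 mulr1.
rewrite big_ord_recr /= mulrDl addrA IH exprMn_comm; last exact: mulrC.
rewrite !exprS exprMn_comm; last exact: mulrC.
by ring.
Qed.

Let remainder N t : Cx R := - z * ((t%:C)%C * z) ^+ N / (1 - (t%:C)%C * z).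

Lemma Re_1B t : complex.Re (1 - (t%:C)%C * z) = 1 - t * x.
Proof. by rewrite ReD ReN ReM /= !mul0r subr0. Qed.

Lemma Im_1B t : complex.Im (1 - (t%:C)%C * z) = - (t * y).
Proof. by rewrite ImD ImN ImM /= mul0r addr0 add0r. Qed.

Lemma modc_remainder N t : modc z < 1 -> 0 <= t <= 1 ->
  modc (remainder N t) <= modc z ^+ N.+1 / (1 - modc z).
Proof.
move=> z1 /andP[t0 t1]; have z0 := modc_ge0 z.
have tm : modc ((t%:C)%C : Cx R) = t.
  by rewrite /modc normc_def /= expr0n addr0 sqrtr_sqr ger0_norm.
have tz : t * modc z <= modc z by rewrite ler_piMl.
have h : 1 - modc z <= modc (1 - (t%:C)%C * z).
  rewrite lerBlDr -[leLHS](@modc1 R).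
  have -> : 1 = (1 - (t%:C)%C * z) + (t%:C)%C * z :> Cx R by rewrite subrK.
  by rewrite (le_trans (modcD _ _))// subrK modcM tm lerD2l.
rewrite /remainder !modcM modcN modcV modcX modcM tm exprS -!mulrA.
rewrite ler_wpM2l// ler_pM ?exprn_ge0 ?invr_ge0 ?mulr_ge0 ?modc_ge0//.
  by rewrite lerXn2r// nnegrE mulr_ge0.
by rewrite lef_pV2// posrE ?subr_gt0// (lt_le_trans _ h)// subr_gt0.
Qed.

Lemma den_gt0 t : 0 < 1 - t * x -> 0 < den t.
Proof. by move=> h; rewrite ltr_wpDr ?sqr_ge0// exprn_gt0. Qed.

Lemma remainderE N t : 0 < 1 - t * x -> remainder N t =
  (((- x * (1 - t * x) + t * y ^+ 2) / den t +
     \sum_(k < N) t ^+ k * complex.Re (z ^+ k.+1))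
   +i* (- y / den t + \sum_(k < N) t ^+ k * complex.Im (z ^+ k.+1)))%C.
Proof.
move=> h; have d0 := den_gt0 h; rewrite /remainder -geometric_remainder ?gt_eqF//.
have pw k : ((t%:C)%C : Cx R) ^+ k = ((t ^+ k)%:C)%C by rewrite rmorphXn.
apply: Cx_eq.
  rewrite ReD Re_sum [RHS]/=; congr (_ + _).
    rewrite ReM ReV ImV Re_1B Im_1B sqrrN ReN ImN /= /den; field.
    by rewrite gt_eqF.
  by apply: eq_bigr => k _; rewrite pw ReM /= mul0r subr0.
rewrite ImD Im_sum [RHS]/=; congr (_ + _).
  rewrite ImM ReV ImV Re_1B Im_1B sqrrN ReN ImN /= /den; field.
  by rewrite gt_eqF.
by apply: eq_bigr => k _; rewrite pw ImM /= mul0r addr0.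
Qed.

Lemma is_derive_Re_clog t : 0 < 1 - t * x ->
  is_derive t 1 (fun t => ln (den t) / 2)
    ((- x * (1 - t * x) + t * y ^+ 2) / den t).
Proof.
move=> h; have d0 := den_gt0 h.
have -> : (fun t => ln (den t) / 2) = 2^-1 \*: (@ln R \o den).
  by apply/funext => u; rewrite /= mulrC.
have dd : is_derive t 1 den (2 * (- x * (1 - t * x) + t * y ^+ 2)).
  have -> : den = (cst 1 - x \*: id) ^+ 2 + (y \*: id) ^+ 2.
    by apply/funext => u; rewrite /den [u * x]mulrC [u * y]mulrC.
  apply: is_derive_eq; rewrite /GRing.scale /= !fctE /=.
  by rewrite /GRing.scale /=; ring.
have := is_derive1_comp (is_derive1_ln d0) dd => dc.
apply: is_derive_eq; rewrite /GRing.scale /=; field.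
by rewrite gt_eqF.
Qed.

Lemma is_derive_Im_clog t : 0 < 1 - t * x ->
  is_derive t 1 (fun t => atan (- (t * y) / (1 - t * x))) (- y / den t).
Proof.
move=> h; have d0 := den_gt0 h; have n0 : 1 - t * x != 0 by rewrite gt_eqF.
have dw : is_derive t 1 (cst 1 - x \*: id : R -> R) (- x).
  by apply: is_derive_eq; rewrite /GRing.scale /= mulr1 sub0r.
have wt : (cst 1 - x \*: id : R -> R) t = 1 - t * x.
  by rewrite !fctE /= /GRing.scale /= mulrC.
have dv : is_derive t 1 (fun t => (1 - t * x)^-1) (x / (1 - t * x) ^+ 2).
  have -> : (fun t => (1 - t * x)^-1) =
      (fun t => ((cst 1 - x \*: id : R -> R) t)^-1).
    by apply/funext => v; rewrite !fctE /= /GRing.scale /= [x * v]mulrC.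
  apply: is_derive_eq; first by apply: is_deriveV; rewrite wt.
  by rewrite wt /GRing.scale /= mulrNN mulrC.
have -> : (fun t => atan (- (t * y) / (1 - t * x))) =
    @atan R \o ((- y \*: id) * (fun t => (1 - t * x)^-1)).
  apply/funext => v; rewrite !fctE /= /GRing.scale /=.
  by congr (atan (_ * _)); rewrite mulNr mulrC.
have du : is_derive t 1 ((- y \*: id) * (fun t => (1 - t * x)^-1))
    (- y / (1 - t * x) ^+ 2).
  by apply: is_derive_eq; do 2 rewrite /GRing.scale /=; field.
apply: (is_derive_eq (is_derive1_comp (is_derive1_atan _) du)).
have -> : (- y \*: id * (fun t => (1 - t * x)^-1)) t = - y * t / (1 - t * x).
  by [].
move: d0; rewrite /den.
move: (1 - t * x) n0 => w w0; set D := w ^+ 2 + _ => D0.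
have -> : 1 + (- y * t / w) ^+ 2 = D / w ^+ 2 by rewrite /D; field.
by rewrite invf_div; field; rewrite w0 gt_eqF.
Qed.

End Series.

(** The partial sums of the logarithmic series converge at a geometric rate:
    the mean value theorem along the segment from 0 to [z] bounds the error by
    the geometric remainder of the derivative. *)
Lemma clog_series_bound z N : modc z < 1 ->
  modc (clog (1 - z) + \sum_(k < N) z ^+ k.+1 / k.+1%:R) <=
  2 * (modc z ^+ N.+1 / (1 - modc z)).
Proof.
case: z => x y; set z := (x +i* y)%C => z1.
have hx : `|x| < 1 by apply: le_lt_trans z1; exact: (Re_le_modc z).
have pos t : t \in `[0, 1] -> 0 < 1 - t * x.
  rewrite in_itv /= => /andP[t0 t1]; rewrite subr_gt0.
  apply: le_lt_trans hx; rewrite (le_trans (ler_norm _))// normrM ger0_norm//.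
  by rewrite ler_piMl.
have mvt (f df : R -> R) : (forall t, t \in `[0, 1] -> is_derive t 1 f (df t)) ->
    f 0 = 0 -> exists2 t, t \in `[0, 1] & f 1 = df t.
  move=> fd f0.
  have d01 t : t \in `]0, 1[ -> is_derive t 1 f (df t).
    by move=> t01; apply: fd; exact: subset_itv_oo_cc.
  have c01 : {within `[0, 1], continuous f}.
    by apply: derivable_within_continuous => t t01; have [] := fd t t01.
  have [t t01] := MVT_segment ler01 d01 c01.
  by rewrite f0 !subr0 mulr1 => ->; exists t.
have bound t : t \in `[0, 1] -> modc (- z * ((t%:C)%C * z) ^+ N /
    (1 - (t%:C)%C * z)) <= modc z ^+ N.+1 / (1 - modc z).
  by rewrite in_itv; exact: modc_remainder.
have pd (c : nat -> R) := @is_derive_power_sum c N.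
have p0 (c : nat -> R) : \sum_(k < N) 0 ^+ k.+1 * (c k / k.+1%:R) = 0 :> R.
  by rewrite big1// => k _; rewrite expr0n mul0r.
rewrite mulr2n mulrDl !mul1r; apply: le_trans (modc_le _) _; apply: lerD.
  have [t|//|t t01] := mvt (fun t => ln ((1 - t * x) ^+ 2 + (t * y) ^+ 2) / 2 +
    \sum_(k < N) t ^+ k.+1 * (complex.Re (z ^+ k.+1) / k.+1%:R)) (fun t =>
    complex.Re (- z * ((t%:C)%C * z) ^+ N / (1 - (t%:C)%C * z))).
  - move=> /pos t01; rewrite remainderE//.
    apply: is_deriveD; first exact: is_derive_Re_clog.
    exact: (pd (fun k => complex.Re (z ^+ k.+1))).
  - rewrite (p0 (fun k => complex.Re (z ^+ k.+1))) !mul0r subr0 expr1n expr0n.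
    by rewrite !addr0 ln1 mul0r.
  move=> h; suff -> : complex.Re (clog (1 - z) + \sum_(k < N) z ^+ k.+1 / k.+1%:R)
     = complex.Re (- z * ((t%:C)%C * z) ^+ N / (1 - (t%:C)%C * z)).
    by apply: le_trans (Re_le_modc _) _; exact: bound.
  rewrite -h ReD Re_sum; congr (_ + _).
    by rewrite /= sub0r sqrrN !mul1r.
  by apply: eq_bigr => k _; rewrite expr1n mul1r Re_divn.
have [t|//|t t01] := mvt (fun t => atan (- (t * y) / (1 - t * x)) +
  \sum_(k < N) t ^+ k.+1 * (complex.Im (z ^+ k.+1) / k.+1%:R)) (fun t =>
  complex.Im (- z * ((t%:C)%C * z) ^+ N / (1 - (t%:C)%C * z))).
- move=> /pos t01; rewrite remainderE//.
  apply: is_deriveD; first exact: is_derive_Im_clog.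
  exact: (pd (fun k => complex.Im (z ^+ k.+1))).
- rewrite (p0 (fun k => complex.Im (z ^+ k.+1))) !mul0r oppr0 mul0r.
  by rewrite atan0 addr0.
move=> h; suff -> : complex.Im (clog (1 - z) + \sum_(k < N) z ^+ k.+1 / k.+1%:R)
   = complex.Im (- z * ((t%:C)%C * z) ^+ N / (1 - (t%:C)%C * z)).
  by apply: le_trans (Im_le_modc _) _; exact: bound.
rewrite -h ImD Im_sum; congr (_ + _).
  by rewrite /= sub0r !mul1r.
by apply: eq_bigr => k _; rewrite expr1n mul1r Im_divn.
Qed.

Lemma Re_1B_gt0 z : modc z < 1 -> 0 < complex.Re (1 - z).
Proof.
move=> z1; rewrite ReD ReN subr_gt0.
by apply: le_lt_trans z1; apply: le_trans (Re_le_modc z); exact: ler_norm.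
Qed.

Lemma cvg_clog_series z : modc z < 1 ->
  series (fun k => z ^+ k.+1 / k.+1%:R) @ \oo --> - clog (1 - z).
Proof.
move=> z1; apply: cvg_modc.
have hg : 2 * (modc z ^+ N.+1 / (1 - modc z)) @[N --> \oo] --> (0 : R).
  have -> : (fun N => 2 * (modc z ^+ N.+1 / (1 - modc z))) =
      geometric (2 * (modc z / (1 - modc z))) (modc z).
    by apply/funext => N; rewrite /geometric /= exprS; ring.
  by apply: cvg_geometric; rewrite ger0_norm// modc_ge0.
apply: (squeeze_cvgr _ _ hg); last exact: cvg_cst.
near=> N; rewrite modc_ge0 /= /series /= big_mkord opprK addrC.
exact: clog_series_bound.
Unshelve. all: by end_near. Qed.

(** By multiplicativity the logarithm at [w + h] is the one at [w] plus the one
    at [1 + h / w], for which the first partial sum of the series has a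
    quadratic error. *)
Lemma clog_differentiable w : 0 < complex.Re w -> differentiable clog w.
Proof.
move=> w0.
apply: (@quadratic_differentiable _ _ w w^-1 (4 * (modc w)^-1 ^+ 2)
  (Num.min (modc w / 2) (complex.Re w))).
  have : 0 < modc w by rewrite (lt_le_trans w0)// (le_trans (ler_norm _))// Re_le_modc.
  by move=> m0; rewrite lt_min w0 divr_gt0.
move=> h; rewrite lt_min => /andP[h1 h2].
have m0 : 0 < modc w by rewrite (lt_le_trans w0)// (le_trans (ler_norm _))// Re_le_modc.
have n0 : w != 0 by rewrite -modc_gt0.
set u := - h / w.
have mu : modc u = modc h / modc w by rewrite /u modcM modcN modcV.
have u1 : modc u <= 1 / 2 by rewrite mu ler_pdivrMr//; lra.
have wE : w + h = w * (1 - u) by rewrite /u; field.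
have -> : clog (w + h) = clog w + clog (1 - u).
  rewrite wE clogM -?wE// ?Re_1B_gt0//; first by lra.
  rewrite ReD; have := Re_le_modc h; rewrite ler_norml => /andP[]; lra.
have -> : clog w + clog (1 - u) - clog w - w^-1 * h =
    clog (1 - u) + \sum_(k < 1) u ^+ k.+1 / k.+1%:R.
  by rewrite big_ord1 expr1 divr1 /u; ring.
apply: le_trans (clog_series_bound 1 _) _; first by lra.
have -> : 4 * (modc w)^-1 ^+ 2 * modc h ^+ 2 = 4 * modc u ^+ 2.
  by rewrite mu exprMn; ring.
have -> : 4 * modc u ^+ 2 = 2 * (modc u ^+ 2 * 2) by ring.
rewrite ler_pM2l// ler_wpM2l ?sqr_ge0// -[leRHS]invrK lef_pV2 ?posrE; lra.
Qed.

End PrincipalLogarithm.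

(** * Continuous logarithms on segments *)

Section LogarithmsOnPaths.
Variable R : realType.
Implicit Types x y t : R.

(** Precomposing with [clamp] turns paths and homotopies that are continuous
    only on [[0, 1]] into functions continuous everywhere. *)
Definition clamp x : R := Num.max 0 (Num.min 1 x).

Lemma clamp_itv x : clamp x \in `[0, 1].
Proof. by rewrite in_itv /= le_max lexx ge_max ler01 ge_min lexx. Qed.

Lemma clamp_id x : x \in `[0, 1] -> clamp x = x.
Proof. by rewrite in_itv => /andP[x0 x1]; rewrite /clamp (min_r x1) max_r. Qed.

Lemma clamp_continuous : continuous clamp.
Proof.
move=> x; apply: (@continuous_max _ _ (cst 0) (fun x => Num.min 1 x)).
  exact: cvg_cst.
by apply: (@continuous_min _ _ (cst 1) id); [exact: cvg_cst|exact: cvg_id].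
Qed.

Lemma within_comp_continuous (T U V : topologicalType) (A : set T) (f : T -> U)
    (g : V -> T) : {within A, continuous f} -> continuous g ->
  (forall v, A (g v)) -> continuous (f \o g).
Proof.
move=> /subspace_continuousP fA gc gA v.
apply: (cvg_comp _ _ _ (fA _ (gA v))) => B /= hB.
have h : nbhs v [set u | A (g u) -> B (g u)] := gc v _ hB.
change (nbhs v [set u | B (g u)]).
by apply: filterS h => u; apply.
Qed.

Lemma paste_continuous (T : topologicalType) (a : R) (f g : R -> T) :
  continuous f -> continuous g -> f a = g a ->
  continuous (fun x => if x <= a then f x else g x).
Proof.
move=> fc gc fg x B /= hB.
change (\forall y \near x, B (if y <= a then f y else g y)).
move: hB; case: (ltgtP x a) => [xa|xa|->] hB.
- have h : \forall y \near x, B (f y) := fc x _ hB.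
  have xl : \forall y \near x, y < a by exact: lt_nbhsl.
  by near=> y; rewrite (ltW (near xl y _))//; near: y.
- have h : \forall y \near x, B (g y) := gc x _ hB.
  have xl : \forall y \near x, a < y by exact: lt_nbhsr.
  by near=> y; rewrite leNgt (near xl y _)//; near: y.
- have h : \forall y \near a, B (f y) := fc a _ hB.
  have h' : \forall y \near a, B (g y) by apply: (gc a); rewrite -fg.
  by near=> y; case: ifP => _; near: y.
Unshelve. all: by end_near. Qed.

(** Near a point, values of [K] differ by less than a period, hence agree; so
    [K] is locally constant and its derivative vanishes. *)
Lemma cexp_cst (K : R -> Cx R) : continuous K ->
  (forall x y, cexp (K x) = cexp (K y)) -> forall x y, K x = K y.
Proof.
move=> Kc Ke.
have Kl x : \forall y \near x, K y = K x.
  have pi20 : 0 < 2 * pi :> R by rewrite mulr_gt0// pi_gt0.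
  apply: filterS (near_modc (nbhs_filter x) (Kc x) pi20) => y hy.
  apply/eqP; rewrite -subr_eq0; apply/eqP; apply: cexp_eq1.
    by rewrite cexpB (Ke y x) divff// cexp_neq0.
  exact: le_lt_trans (Im_le_modc _) hy.
have dr x : is_derive x 1 (@complex.Re R \o K) 0.
  apply: (@near_eq_is_derive _ _ _ (cst (complex.Re (K x)))).
    by apply: filterS (Kl x) => y /= ->.
  exact: is_derive_cst.
have di x : is_derive x 1 (@complex.Im R \o K) 0.
  apply: (@near_eq_is_derive _ _ _ (cst (complex.Im (K x)))).
    by apply: filterS (Kl x) => y /= ->.
  exact: is_derive_cst.
move=> x y; apply: Cx_eq.
  exact: (is_derive_0_is_cst (f := @complex.Re R \o K) x y dr).
exact: (is_derive_0_is_cst (f := @complex.Im R \o K) x y di).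
Qed.

(** The uniform estimate that lets [clog] be applied to the ratio of any two
    values near [c]. *)
Lemma Re_ratio_gt0 (a b c : Cx R) : modc (a - c) < modc c / 3 ->
  modc (b - c) < modc c / 3 -> 0 < complex.Re (a / b).
Proof.
move=> ha hb.
have hc : modc c <= modc b + modc (b - c).
  by have := modcD b (- (b - c)); rewrite modcN opprB addrC subrK.
have b0 : 0 < modc b by have := modc_ge0 c; lra.
have -> : a / b = 1 - (b - a) / b.
  by rewrite mulrBl divff -?modc_gt0// opprB addrC subrK.
apply: Re_1B_gt0; rewrite modcM modcV ltr_pdivrMr// mul1r.
have : modc (b - a) <= modc (b - c) + modc (a - c).
  by have := modcD (b - c) (- (a - c)); rewrite modcN opprB addrA subrK.
by lra.
Qed.

(** Cutting the segment from [(0, x)] to [(1, x)] into [N] pieces, with [N]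
    uniform in [x], writes [U 1 x / U 0 x] as a product of ratios close to 1;
    the sum of their principal logarithms is a continuous logarithm. *)
Lemma log_ratio (U : R * R -> Cx R) : continuous U -> (forall q, U q != 0) ->
  exists l : R -> Cx R, [/\ continuous l,
    forall x, x \in `[0, 1] -> cexp (l x) = U (1, x) / U (0, x) &
    forall x, x \in `[0, 1] -> (forall y, U (y, x) = U (0, x)) -> l x = 0].
Proof.
move=> Uc U0.
pose P (N : nat) (q : R * R) := forall y, `|y - q.1| <= N.+1%:R^-1 ->
  0 < complex.Re (U (y, q.2) / U q).
have : \forall N \near \oo, (`[0, 1] `*` `[0, 1])%classic `<=` P N.
  have cK : compact (`[0, 1] `*` `[0, 1] : set (R * R)).
    by apply: compact_setX; exact: segment_compact.
  have /compact_near_coveringP nc := cK.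
  apply: (nc nat \oo P) => q _ /=.
  have : \forall q' \near q, modc (U q' - U q) < modc (U q) / 3.
    apply: (near_modc (nbhs_filter q) (Uc q)).
    by rewrite divr_gt0// modc_gt0.
  move=> /nbhs_ballP[e /= e0 he].
  have e20 : 0 < e / 2 by rewrite divr_gt0.
  exists (ball q (e / 2), [set N | N.+1%:R^-1 < e / 2]) => /=.
    split; first exact: nbhsx_ballx.
    by apply: near_infty_natSinv_lt (PosNum e20).
  case=> [[y x] N] /= [[/= hy hx] hN] z /= hz.
  apply: (@Re_ratio_gt0 _ _ (U q)); apply: he; split => /=.
  - rewrite /ball /= in hy *.
    have -> : q.1 - z = (q.1 - y) - (z - y) by rewrite opprB addrA subrK.
    by rewrite (le_lt_trans (ler_normB _ _))// [ltRHS]splitr ltrD// (le_lt_trans hz).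
  - by apply: le_ball hx; lra.
  - by apply: le_ball hy; lra.
  - by apply: le_ball hx; lra.
move=> [N _ /(_ N (leqnn N)) hN].
pose g i (x : R) : Cx R := U (i.+1%:R / N.+1%:R, x) / U (i%:R / N.+1%:R, x).
have gp i x : (i < N.+1)%N -> x \in `[0, 1] -> 0 < complex.Re (g i x).
  move=> iN x01; apply: (hN (i%:R / N.+1%:R, x)).
    split => //=; rewrite in_itv /= divr_ge0//= ler_pdivrMr// mul1r ler_nat.
    exact: ltnW.
  by rewrite /= -mulrBl -natrB// subSnn mul1r ger0_norm.
pose l x := \sum_(i < N.+1) clog (g i (clamp x)).
exists l; split.
- move=> x; apply: (@cvg_big _ _ +%R) => [|i _]; first exact: add_continuous.
  apply: cvg_clog; first exact/gp/clamp_itv.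
  have Uk (y : R) : U (y, clamp x') @[x' --> x] --> U (y, clamp x).
    have h : (y, clamp x') @[x' --> x] --> (y, clamp x).
      exact: (cvg_pair (cvg_cst y) (@clamp_continuous x)).
    exact: (cvg_comp _ _ h (Uc _)).
  by apply: cvgM => //; apply: cvgV.
- move=> x x01; rewrite /l (clamp_id x01).
  have -> : U (1, x) / U (0, x) = \prod_(i < N.+1) g i x.
    have : forall k, \prod_(i < k) g i x = U (k%:R / N.+1%:R, x) / U (0, x).
      elim=> [|k IH]; first by rewrite big_ord0 mul0r divff.
      by rewrite big_ord_recr /= IH mulrC /g mulrA divfK.
    by move->; rewrite divff.
  rewrite (big_morph _ (@cexpD R) (cexp0 R)); apply: eq_bigr => i _.
  by rewrite clogK//; apply: gp.
- move=> x x01 h; rewrite /l (clamp_id x01) big1// => i _.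
  by rewrite /g !h divff// clog1.
Qed.

End LogarithmsOnPaths.

(** * Logarithms on a simply connected covering *)

Section LogarithmOnCovering.
Variables (R : realType) (S : topologicalType).
Implicit Types (x y : R) (w : S -> Cx R).

(** Contracting the path to its origin, [U (y, x) = w (c (y x))], makes
    [log_ratio] applicable. *)
Lemma path_log w (c : R -> S) : continuous w -> (forall s, w s != 0) ->
  continuous c ->
  exists l : R -> Cx R, [/\ continuous l, l 0 = 0 &
    forall x, x \in `[0, 1] -> cexp (l x) = w (c x) / w (c 0)].
Proof.
move=> wc w0 cc; pose U (q : R * R) := w (c (q.1 * q.2)).
have Uc : continuous U.
  move=> q; have h : q'.1 * q'.2 @[q' --> q] --> q.1 * q.2.
    by apply: cvgM; [exact: cvg_fst|exact: cvg_snd].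
  exact: (cvg_comp _ _ (cvg_comp _ _ h (cc _)) (wc _)).
have [l [lc le l0]] := log_ratio Uc (fun q => w0 _).
exists l; split=> //.
  by apply: l0 => [|y]; rewrite ?in_itv/= ?lexx ?ler01// /U /= !mulr0.
by move=> x x01; rewrite le// /U /= mul1r mul0r.
Qed.

(** On a null-homotopy of the loop the two vertical sides stay at the base
    point, so the logarithm given by [log_ratio] vanishes at both ends; any
    other logarithm along the loop differs from it by a constant. *)
Lemma loop_log w (c : R -> S) (l : R -> Cx R) (k : Cx R) :
  simply_connected R S -> continuous w -> (forall s, w s != 0) ->
  continuous c -> c 0 = c 1 -> continuous l ->
  (forall x, x \in `[0, 1] -> cexp (l x) = w (c x) * k) -> l 0 = l 1.
Proof.
move=> [_ sc] wc w0 cc c01 lc le.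
have i0 : (0 : R) \in `[0, 1] by rewrite in_itv /= lexx ler01.
have i1 : (1 : R) \in `[0, 1] by rewrite in_itv /= lexx ler01.
have [H [Hc H0 H1 Hs]] := sc c (continuous_subspaceT cc) c01.
pose sq (q : R * R) : R * R := (clamp (1 - q.1), clamp q.2).
have sqc : continuous sq.
  move=> q.
  have h1 : clamp (1 - q'.1) @[q' --> q] --> clamp (1 - q.1).
    have h : 1 - q'.1 @[q' --> q] --> 1 - q.1.
      by apply: cvgB; [exact: cvg_cst|exact: cvg_fst].
    exact: (cvg_comp _ _ h (@clamp_continuous R _)).
  have h2 : clamp q'.2 @[q' --> q] --> clamp q.2.
    have h : q'.2 @[q' --> q] --> q.2 by exact: cvg_snd.
    exact: (cvg_comp _ _ h (@clamp_continuous R _)).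
  exact: (cvg_pair h1 h2).
have Hsq : continuous (H \o sq).
  apply: (within_comp_continuous Hc sqc) => q.
  by split; exact: clamp_itv.
have Uc : continuous (w \o (H \o sq)).
  by move=> q; exact: (cvg_comp _ _ (Hsq q) (wc _)).
have [m [mc me m0]] := log_ratio Uc (fun q => w0 _).
have mE x : x \in `[0, 1] -> cexp (m x) = w (c x) / w (c 0).
  move=> x01; rewrite me// /sq /= subrr subr0 !clamp_id//.
  by rewrite H0// H1.
have mend x : x \in `[0, 1] -> (forall y, H (clamp (1 - y), x) = c 0) -> m x = 0.
  by move=> x01 h; apply: m0 => // y; rewrite /= /sq /= (clamp_id x01) !h.
have m00 : m 0 = 0 by apply: mend => // y; have [] := Hs _ (clamp_itv (1 - y)).
have m10 : m 1 = 0 by apply: mend => // y; have [] := Hs _ (clamp_itv (1 - y)).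
pose K x := l (clamp x) - m (clamp x).
have Kc : continuous K.
  move=> x; apply: cvgB.
    exact: (cvg_comp _ _ (@clamp_continuous R x) (lc _)).
  exact: (cvg_comp _ _ (@clamp_continuous R x) (mc _)).
have Ke x : cexp (K x) = w (c 0) * k.
  have x01 := clamp_itv x; rewrite /K cexpB le// mE//.
  by field; rewrite !w0.
have := cexp_cst Kc (fun x y => etrans (Ke x) (esym (Ke y))) 0 1.
by rewrite /K !clamp_id// m00 m10 !subr0.
Qed.

Lemma cexp_cst_path_connected (K : S -> Cx R) : path_connected R S ->
  continuous K -> (forall s s', cexp (K s) = cexp (K s')) ->
  forall s s', K s = K s'.
Proof.
move=> pc Kc Ke s s'; have [c [cc c0 c1]] := pc s s'.
have gc : continuous (c \o @clamp R).
  exact: (within_comp_continuous cc (@clamp_continuous R) (@clamp_itv R)).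
have Kgc : continuous (K \o (c \o @clamp R)).
  by move=> x; exact: (cvg_comp _ _ (gc x) (Kc _)).
have := cexp_cst Kgc (fun x y => Ke _ _) 0 1.
by rewrite /= !clamp_id ?in_itv /= ?lexx ?ler01// c0 c1.
Qed.

(** The logarithm along paths from [s0]; by [loop_log] it does not depend on
    the path. Near [s1], comparing the path chosen for [s] with the path for
    [s1] followed by a segment in the sheet of [s1] shows that it is the
    principal logarithm of a ratio up to a constant. *)
Lemma log_lift n (p : S -> 'cV[Cx R]_n) (U : set 'cV[Cx R]_n)
    (v : 'cV[Cx R]_n -> Cx R) (s0 : S) :
  simply_connected R S -> covering p U -> continuous v ->
  (forall s, v (p s) != 0) ->
  exists L : S -> Cx R, (forall s, cexp (L s) = v (p s) / v (p s0)) /\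
    forall s1, \forall s \near s1, L s = L s1 + clog (v (p s) / v (p s1)).
Proof.
move=> sc [pc pU pcov] vc v0; pose w := v \o p.
have i0 : (0 : R) \in `[0, 1] by rewrite in_itv /= lexx ler01.
have i1 : (1 : R) \in `[0, 1] by rewrite in_itv /= lexx ler01.
have wc : continuous w.
  by move=> s; exact: (cvg_comp _ _ (pc s) (vc _)).
have cl (s : S) : exists cl : (R -> S) * (R -> Cx R),
    [/\ continuous cl.1, cl.1 0 = s0, cl.1 1 = s, continuous cl.2 & cl.2 0 = 0 /\
      forall x, x \in `[0, 1] -> cexp (cl.2 x) = w (cl.1 x) / w s0].
  have [c [cc c0 c1]] := sc.1 s0 s.
  have gc : continuous (c \o @clamp R).
    exact: (within_comp_continuous cc (@clamp_continuous R) (@clamp_itv R)).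
  have [l [lc l0 le]] := path_log wc v0 gc.
  have g0 : (c \o @clamp R) 0 = s0 by rewrite /= clamp_id.
  exists (c \o @clamp R, l); split => //=; first by rewrite clamp_id.
  by split=> // x x01; rewrite le// g0.
have [CL hCL] := choice cl; exists (fun s => (CL s).2 1); split.
  by move=> s; have [_ _ c1 _ [_ ->//]] := hCL s; rewrite c1.
move=> s1; have [V [oV Vs1 VU [I [sigma [sgK sgc sgo sgu]]]]] := pcov (p s1)
  (eq_rect _ (fun A : set _ => A (p s1)) (imageT p s1) _ pU).
have [i [si _]] := sgu s1 Vs1.
have : \forall t \near p s1, V t /\ modc (v t / v (p s1) - 1) < 1.
  apply: filterI; first exact: open_nbhs_nbhs.
  apply: (near_modc (nbhs_filter (p s1))); last exact: ltr01.
  rewrite -(divff (v0 s1)).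
  by apply: cvgMr_tmp; exact: vc.
move=> /nbhs_normP[e /= e0 he].
have near1 : \forall s \near s1, (sigma i @` V) s.
  by apply: open_nbhs_nbhs; split => //; exists (p s1).
have near2 : \forall s \near s1, `|p s1 - p s| < e.
  have : p s @[s --> s1] --> p s1 by exact: pc.
  by move=> /cvgrPdist_lt; apply.
near=> s.
have [t Vt ts] : (sigma i @` V) s by near: s.
have se : `|p s1 - p s| < e by near: s.
have {t Vt ts} sgs : sigma i (p s) = s by rewrite -ts sgK.
pose seg x : 'cV[Cx R]_n := p s1 + ((clamp x)%:C)%C *: (p s - p s1).
have segV x : V (seg x) /\ modc (v (seg x) / v (p s1) - 1) < 1.
  apply: he; rewrite /= /seg opprD addNKr normrN normrZ.
  apply: le_lt_trans se; rewrite distrC ler_piMl//.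
  have := clamp_itv x; rewrite in_itv /= => /andP[h0 h1].
  by rewrite modcE lecR /modc normc_def /= expr0n addr0 sqrtr_sqr ger0_norm.
have segc : continuous seg.
  move=> x; apply: cvgD; first exact: cvg_cst.
  apply: cvgZr_tmp.
  exact: (cvg_comp _ _ (@clamp_continuous R x) (@real_complex_continuous R _)).
have dc : continuous (sigma i \o seg).
  by apply: (within_comp_continuous (sgc i) segc) => x; have [] := segV x.
have pd x : p (sigma i (seg x)) = seg x by rewrite sgK//; have [] := segV x.
have seg0 : seg 0 = p s1 by rewrite /seg clamp_id// scale0r addr0.
have seg1 : seg 1 = p s by rewrite /seg clamp_id// scale1r subrKC.
have segRe x : 0 < complex.Re (v (seg x) / v (p s1)).
  have [_ h] := segV x.
  have -> : v (seg x) / v (p s1) = 1 - (1 - v (seg x) / v (p s1)) by rewrite subKr.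
  by apply: Re_1B_gt0; rewrite -modcN opprB.
have [c1c c10 c11 l1c [l10 l1e]] := hCL s1.
have [c2c c20 c21 l2c [l20 l2e]] := hCL s.
move: (CL s1) (CL s) c1c c10 c11 l1c l10 l1e c2c c20 c21 l2c l20 l2e.
move=> [c1 l1] [c2 l2] /= c1c c10 c11 l1c l10 l1e c2c c20 c21 l2c l20 l2e.
pose ld x := clog (v (seg x) / v (p s1)).
have ldc : continuous ld.
  move=> x; apply: cvg_clog => //; apply: cvgMr_tmp.
  exact: (cvg_comp _ _ (segc x) (vc _)).
have ld0 : ld 0 = 0 by rewrite /ld seg0 divff// clog1.
have -> : clog (v (p s) / v (p s1)) = ld 1 by rewrite /ld seg1.
(* the loop: the path to s1, the segment to s, and back along the path to s *)
pose G x := if x <= 2 then (if x <= 1 then c1 x else sigma i (seg (x - 1)))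
  else c2 (3 - x).
pose k := l1 1 + ld 1 - l2 1.
pose LG x := if x <= 2 then (if x <= 1 then l1 x else l1 1 + ld (x - 1))
  else l2 (3 - x) + k.
have shift_c (a : R) : continuous (fun x : R => x - a).
  by move=> x; apply: cvgB; [exact: cvg_id|exact: cvg_cst].
have flip_c : continuous (fun x : R => 3 - x).
  by move=> x; apply: cvgB; [exact: cvg_cst|exact: cvg_id].
have n21 : (2 <= 1 :> R) = false by lra.
have e21 : 2 - 1 = 1 :> R by lra.
have e32 : 3 - 2 = 1 :> R by lra.
have Gc : continuous G.
  apply: paste_continuous; last by rewrite n21 e21 e32 seg1 sgs c21.
    apply: (paste_continuous c1c); last by rewrite subrr seg0 si c11.
    by move=> x; exact: (cvg_comp _ _ (shift_c 1 x) (dc _)).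
  by move=> x; exact: (cvg_comp _ _ (flip_c x) (c2c _)).
have LGc : continuous LG.
  apply: paste_continuous; last by rewrite n21 e21 e32 /k subrKC.
    apply: (paste_continuous l1c); last by rewrite subrr ld0 addr0.
    move=> x; apply: cvgD; first exact: cvg_cst.
    exact: (cvg_comp _ _ (shift_c 1 x) (ldc _)).
  move=> x; apply: cvgD; last exact: cvg_cst.
  exact: (cvg_comp _ _ (flip_c x) (l2c _)).
have ek : cexp k = 1.
  rewrite /k cexpB cexpD l1e// l2e// c11 c21 clogK// seg1 /w /=.
  by field; rewrite !v0.
have sc3 : continuous (fun x : R => 3 * x).
  by move=> x; apply: cvgMl_tmp; exact: cvg_id.
have LG1 : LG 3 = k.
  rewrite /LG subrr l20 add0r; suff -> : (3 <= 2 :> R) = false by [].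
  by lra.
suff : LG 0 = LG 3.
  rewrite LG1 /LG ler0n ler01 l10 /k => /esym/eqP.
  by rewrite subr_eq0 => /eqP.
have -> : LG 0 = LG (3 * 0) by rewrite mulr0.
have -> : LG 3 = LG (3 * 1) by rewrite mulr1.
have G3c : continuous (fun x => G (3 * x)).
  by move=> x; exact: (cvg_comp _ _ (sc3 x) (Gc _)).
have LG3c : continuous (fun x => LG (3 * x)).
  by move=> x; exact: (cvg_comp _ _ (sc3 x) (LGc _)).
have G3 : G (3 * 0) = G (3 * 1).
  rewrite mulr0 mulr1 /G ler0n ler01 c10 subrr c20.
  by suff -> : (3 <= 2 :> R) = false by []; lra.
apply: (loop_log sc wc v0 G3c G3 LG3c (k := (w s0)^-1)).
move=> x; rewrite in_itv /= => /andP[x0 x1].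
rewrite /LG /G; case: (leP (3 * x) 2) => h2; last first.
  by rewrite cexpD ek mulr1 l2e// in_itv /=; lra.
case: (leP (3 * x) 1) => h1; first by rewrite l1e// in_itv /=; lra.
rewrite cexpD l1e// c11 clogK// /w /= pd.
by field; rewrite !v0.
Unshelve. all: by end_near. Qed.

End LogarithmOnCovering.

(** * The contribution of a single class *)

Section ClassForcing.
Variables (R : realType) (n : nat).
Implicit Types (t : 'cV[Cx R]_n) (b : 'rV[int]_n) (eta xi : 'cV[int]_n).

Lemma pairingMn b k eta : pairing (b *+ k) eta = pairing b eta *+ k.
Proof. by rewrite /pairing -scaler_nat -scalemxAl mxE mulr_natl. Qed.

Lemma pairingNl b eta : pairing (- b) eta = - pairing b eta.
Proof. by rewrite /pairing mulNmx mxE. Qed.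

Lemma pairingNr b eta : pairing b (- eta) = - pairing b eta.
Proof. by rewrite /pairing mulmxN mxE. Qed.

Lemma cpairingMn b k t : cpairing (b *+ k) t = k%:R * cpairing b t.
Proof.
by rewrite /cpairing raddfMn -scaler_nat -scalemxAl mxE.
Qed.

Lemma cpairingN b t : cpairing (- b) t = - cpairing b t.
Proof. by rewrite /cpairing raddfN mulNmx mxE. Qed.

Lemma qvarMn b k t : qvar t (b *+ k) = qvar t b ^+ k.
Proof. by rewrite /qvar cpairingMn mulrCA cexpMn. Qed.

Lemma qvarN b t : qvar t (- b) = (qvar t b)^-1.
Proof. by rewrite /qvar cpairingN mulrN cexpN. Qed.

Lemma cexp_geometric (th : Cx R) (m : nat) :
  cexp (th * m%:R) - cexp (- (th * m%:R)) =
  (cexp th - cexp (- th)) * \sum_(j < m) cexp (th * (m%:R - 1 - 2 * j%:R)).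
Proof.
pose f j := cexp (th * (m%:R - 2 * j%:R)).
rewrite mulr_sumr (eq_bigr (fun j : 'I_m => f j - f j.+1)); last first.
  move=> j _; rewrite mulrBl -!cexpD /f; congr (cexp _ - cexp _).
    by ring.
  by rewrite -natr1; ring.
have -> : \sum_(j < m) (f j - f j.+1) = - \sum_(0 <= j < m) (f j.+1 - f j).
  by rewrite big_mkord -sumrN; apply: eq_bigr => j _; rewrite opprB.
rewrite telescope_sumr// opprB /f mulr0 subr0; congr (_ - cexp _); ring.
Qed.

Lemma sgz_abs (a : int) : (a%:~R : Cx R) = (sgz a)%:~R * (`|a|%N)%:R.
Proof.
by rewrite {1}[a]intEsg intrM; congr (_ * _).
Qed.

Lemma cexp_geometric_int (th : Cx R) (a : int) :
  cexp (th * a%:~R) - cexp (- (th * a%:~R)) =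
  (cexp th - cexp (- th)) * ((sgz a)%:~R *
    \sum_(j < `|a|%N) cexp (th * ((`|a|%N)%:R - 1 - 2 * j%:R))).
Proof.
rewrite mulrCA -cexp_geometric [in LHS]sgz_abs.
case: sgzP => _ /=; rewrite ?mul0r ?mulr0 ?mul1r ?mulN1r ?mulrN1.
- by rewrite oppr0 subrr.
- by [].
- by rewrite mulrN opprK opprB.
Qed.

(** Each of the two translation differences is a geometric sum times the
    difference of exponentials in the sine, so the square of the sine cancels
    and the powers of the phases remain. *)
Lemma nabla_potentialE (X : gv_threefold n) (lambda : Cx R) eta xi b k :
  generic lambda ->
  nabla lambda eta (nabla lambda xi (potential X lambda)) b k.+1 =
  - ((gv X b)%:~R * ((sgz (pairing b eta))%:~R * (sgz (pairing b xi))%:~R)) *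
  \sum_(j < `|pairing b eta|%N) \sum_(l < `|pairing b xi|%N)
    phase lambda (pairing b eta) (pairing b xi) j l ^+ k.+1 / k.+1%:R.
Proof.
move=> gen; have := gen k.+1 isT.
rewrite /nabla /half_translation /potential !pairingNr !pairingMn.
set a := pairing b eta; set a' := pairing b xi; set K : Cx R := k.+1%:R.
set th := 'i * (K * lambda / 2).
have K0 : K != 0 by rewrite pnatr_eq0.
have i0 : ('i : Cx R) != 0 by exact: neq0Ci.
rewrite /csin -/th; set e := cexp th - cexp (- th) => e0.
have {}e0 : e != 0 by apply: contraNneq e0 => ->; rewrite mul0r.
have thE (c : int) : 'i * lambda * (c *+ k.+1)%:~R / 2 = th * c%:~R.
  by rewrite rmorphMn /= -mulr_natr /th -/K; ring.
have thNE (c : int) : 'i * lambda * (- (c *+ k.+1))%:~R / 2 = - (th * c%:~R).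
  by rewrite -mulNrn thE rmorphN mulrN.
have factor (u u' w w' c : Cx R) :
    u * (w * c - w' * c) - u' * (w * c - w' * c) = (u - u') * ((w - w') * c).
  by ring.
rewrite (thE a) (thE a') (thNE a) (thNE a').
rewrite factor (cexp_geometric_int th a) (cexp_geometric_int th a') -/e.
have -> : (2 * (e / (2 * 'i))) ^+ 2 = - e ^+ 2.
  have -> : 2 * (e / (2 * 'i)) = e / 'i by field.
  by rewrite expr_div_n sqrCi invrN1 mulrN1.
set A := \sum_(j < `|a|%N) cexp _; set A' := \sum_(l < `|a'|%N) cexp _.
have -> : \sum_(j < `|a|%N) \sum_(l < `|a'|%N) phase lambda a a' j l ^+ k.+1 / K =
    A * A' / K.
  rewrite /A /A' big_distrlr /= mulr_suml; apply: eq_bigr => j _.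
  rewrite mulr_suml; apply: eq_bigr => l _; congr (_ / _).
  rewrite /phase -cexpMn -cexpD; congr cexp.
  by rewrite natrD -addnA addn1 natrD -natr1 /th -/K; field.
clearbody e A A' th; clearbody K.
by field; rewrite K0 e0.
Qed.

Definition forcing_coef (X : gv_threefold n) eta xi b : Cx R :=
  (gv X b)%:~R * ((sgz (pairing b eta))%:~R * (sgz (pairing b xi))%:~R).

Definition pole_factor (ph : Cx R) b t : Cx R := 1 - ph * qvar t b.

Lemma class_forcing0 (X : gv_threefold n) (lambda : Cx R) eta xi b t :
  gv X b = 0 -> class_forcing X lambda eta xi b t = 0.
Proof.
move=> b0; rewrite /class_forcing /class_sum.
rewrite (_ : (fun k => _) = fun=> 0); last first.
  apply/funext => k; rewrite /nabla /half_translation /potential b0.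
  by rewrite !mul0r !mulr0 !subrr !mulr0 subrr mul0r.
rewrite (_ : series _ = fun=> 0) ?lim_cst//.
by apply/funext => N; rewrite /series /= big1.
Qed.

(** The sum over multiple covers turns the powers of a phase into the
    logarithm of its pole factor. *)
Lemma class_forcingE (X : gv_threefold n) (lambda : Cx R) eta xi b t :
  generic lambda ->
  (forall j l : nat, (j < `|pairing b eta|)%N -> (l < `|pairing b xi|)%N ->
    `|phase lambda (pairing b eta) (pairing b xi) j l * qvar t b| < 1) ->
  class_forcing X lambda eta xi b t = forcing_coef X eta xi b *
  \sum_(j < `|pairing b eta|%N) \sum_(l < `|pairing b xi|%N)
    clog (pole_factor (phase lambda (pairing b eta) (pairing b xi) j l) b t).
Proof.
move=> gen small; rewrite /class_forcing /class_sum.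
apply: cvg_lim; first exact: norm_hausdorff.
pose z j l := phase lambda (pairing b eta) (pairing b xi) j l * qvar t b.
rewrite (_ : series _ = fun N => - forcing_coef X eta xi b *
  \sum_(j < `|pairing b eta|%N) \sum_(l < `|pairing b xi|%N)
    series (fun k => z j l ^+ k.+1 / k.+1%:R) N); last first.
  apply/funext => N; rewrite /series /=.
  under eq_bigr => k _.
    rewrite nabla_potentialE// -/(forcing_coef _ _ _ _) qvarMn -mulrA.
    over.
  rewrite -mulr_sumr; congr (_ * _).
  transitivity (\sum_(0 <= k < N) \sum_(j < `|pairing b eta|%N)
      \sum_(l < `|pairing b xi|%N) z j l ^+ k.+1 / k.+1%:R).
    apply: eq_bigr => k _; rewrite mulr_suml; apply: eq_bigr => j _.
    rewrite mulr_suml; apply: eq_bigr => l _.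
    by rewrite /z exprMn mulrAC.
  rewrite exchange_big; apply: eq_bigr => j _.
  by rewrite exchange_big.
rewrite -[X in _ --> X]mulrNN; apply: cvgMl_tmp.
rewrite -sumrN; apply: (@cvg_big _ _ +%R) => [|j _]; first exact: add_continuous.
rewrite -sumrN; apply: (@cvg_big _ _ +%R) => [|l _]; first exact: add_continuous.
by apply: cvg_clog_series; rewrite -ltcR -modcE; exact: small.
Qed.

Lemma cpairing_differentiable b t : differentiable (cpairing b) t.
Proof.
have -> : cpairing b =
    \sum_(j < n) (fun t : 'cV[Cx R]_n => (b ord0 j)%:~R * t j ord0).
  apply/funext => u; rewrite fct_sumE /cpairing mxE.
  by apply: eq_bigr => j _; rewrite mxE.
apply: differentiable_sum => j.
apply: differentiableM; first exact: differentiable_cst.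
exact: differentiable_coord.
Qed.

Lemma qvar_differentiable b t : differentiable (fun t => qvar t b) t.
Proof.
apply: (@differentiable_comp _ _ _ _ (fun t => twopii R * cpairing b t)
  (@cexp R)); last exact: cexp_differentiable.
apply: differentiableM; first exact: differentiable_cst.
exact: cpairing_differentiable.
Qed.

Lemma pole_factor_differentiable ph b t : differentiable (pole_factor ph b) t.
Proof.
apply: differentiableB; first exact: differentiable_cst.
apply: differentiableM; first exact: differentiable_cst.
exact: qvar_differentiable.
Qed.

Lemma pole_factor_continuous ph b : continuous (pole_factor ph b).
Proof.
by move=> t; apply: differentiable_continuous; exact: pole_factor_differentiable.
Qed.

End ClassForcing.

(** * Analytic continuation through logarithms *)

Section Continuation.
Variables (R : realType) (n : nat) (S : topologicalType).
Variable p : S -> 'cV[Cx R]_n.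
Implicit Types (v h : 'cV[Cx R]_n -> Cx R) (f L : S -> Cx R) (s : S).

Lemma holomorphic_over_cst (k : Cx R) : holomorphic_over p (fun=> k).
Proof.
move=> s; exists (cst k); split; last by near=> s'.
by near=> t; exact: differentiable_cst.
Unshelve. all: by end_near. Qed.

Lemma holomorphic_overD f g : holomorphic_over p f -> holomorphic_over p g ->
  holomorphic_over p (fun s => f s + g s).
Proof.
move=> hf hg s; have [F [dF eF]] := hf s; have [G [dG eG]] := hg s.
exists (F + G); split.
  by apply: filterS2 dF dG => t ? ?; exact: differentiableD.
by apply: filterS2 eF eG => s' -> ->.
Qed.

Lemma holomorphic_overM f g : holomorphic_over p f -> holomorphic_over p g ->
  holomorphic_over p (fun s => f s * g s).
Proof.
move=> hf hg s; have [F [dF eF]] := hf s; have [G [dG eG]] := hg s.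
exists (F * G); split.
  by apply: filterS2 dF dG => t ? ?; exact: differentiableM.
by apply: filterS2 eF eG => s' -> ->.
Qed.

Lemma holomorphic_over_sum (I : eqType) (r : seq I) (f : I -> S -> Cx R) :
  (forall i, i \in r -> holomorphic_over p (f i)) ->
  holomorphic_over p (fun s => \sum_(i <- r) f i s).
Proof.
elim: r => [_|i r IH hf].
  under eq_fun do rewrite big_nil; exact: holomorphic_over_cst.
under eq_fun do rewrite big_cons.
apply: holomorphic_overD; first by apply: hf; rewrite mem_head.
by apply: IH => j jr; apply: hf; rewrite in_cons jr orbT.
Qed.

Lemma continuation_sum (I : eqType) (r : seq I) s0
    (h : I -> 'cV[Cx R]_n -> Cx R) (f : I -> S -> Cx R) :
  (forall i, i \in r -> continuation p s0 (h i) (f i)) ->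
  continuation p s0 (fun t => \sum_(i <- r) h i t) (fun s => \sum_(i <- r) f i s).
Proof.
move=> hf; split; first by apply: holomorphic_over_sum => i /hf[].
elim: r hf => [_|i r IH hf]; first by near=> s; rewrite !big_nil.
have [_ hi] := hf i (mem_head _ _).
have hr : \forall s \near s0,
    \sum_(j <- r) f j s = \sum_(j <- r) h j (p s).
  by apply: IH => j jr; apply: hf; rewrite in_cons jr orbT.
by apply: filterS2 hi hr => s e e'; rewrite !big_cons e e'.
Unshelve. all: by end_near. Qed.

(** A branch is taken up to an additive constant: the same [L] can then be
    normalized at the base point of [X] and at that of the flop. *)
Definition log_branch v L : Prop :=
  [/\ forall s, v (p s) != 0,
      exists k, forall s, cexp (L s) = v (p s) * k &
      forall s1, \forall s \near s1, L s = L s1 + clog (v (p s) / v (p s1))].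

Hypothesis pc : continuous p.

Lemma log_branch_continuous v L : continuous v -> log_branch v L ->
  continuous L.
Proof.
move=> vc [v0 _ vL] s1.
have h : L s1 + clog (v (p s) / v (p s1)) @[s --> s1] --> L s1.
  have hv : v (p s) @[s --> s1] --> v (p s1).
    exact: (cvg_comp _ _ (@pc s1) (vc _)).
  have h1 : v (p s) / v (p s1) @[s --> s1] --> (1 : Cx R).
    by rewrite -(divff (v0 s1)); apply: cvgMr_tmp.
  rewrite -[X in _ --> X]addr0 -(@clog1 R); apply: cvgD; first exact: cvg_cst.
  by apply: cvg_clog => //; rewrite /= ltr01.
apply: cvg_trans h; apply: near_eq_cvg.
by apply: filterS (vL s1) => s ->.
Qed.

Lemma Re_div_near v (t1 : 'cV[Cx R]_n) : continuous v -> v t1 != 0 ->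
  \forall t \near t1, 0 < complex.Re (v t / v t1).
Proof.
move=> vc v0; have hv : v t @[t --> t1] --> v t1 by exact: vc.
have h : v t / v t1 @[t --> t1] --> (1 : Cx R).
  by rewrite -(divff v0); exact: (cvgMr_tmp (FF := nbhs_filter t1) hv).
apply: filterS (near_modc (nbhs_filter t1) h ltr01) => t ht.
by rewrite -[_ / _](subKr 1); apply: Re_1B_gt0; rewrite -modcN opprB.
Qed.

Lemma log_branch_holomorphic v L : (forall t, differentiable v t) ->
  log_branch v L -> holomorphic_over p L.
Proof.
move=> vd [v0 _ vL] s1; have vc : continuous v.
  by move=> t; exact: differentiable_continuous.
exists (fun t => L s1 + clog (v t / v (p s1))); split; last exact: vL.
apply: filterS (Re_div_near vc (v0 s1)) => t ht.
apply: differentiableD; first exact: differentiable_cst.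
apply: (@differentiable_comp _ _ _ _ (fun t => v t / v (p s1)) (@clog R)).
  by apply: differentiableM => //; exact: differentiable_cst.
exact: clog_differentiable.
Qed.

Lemma log_branch_near v L s1 : continuous v -> log_branch v L ->
  0 < complex.Re (v (p s1)) ->
  \forall s \near s1, L s + (clog (v (p s1)) - L s1) = clog (v (p s)).
Proof.
move=> vc [v0 _ vL] v1.
have h1 := @pc s1 _ (Re_div_near vc (v0 s1)).
have h2 : \forall s \near s1, 0 < complex.Re (v (p s)).
  have h : complex.Re (v (p s)) @[s --> s1] --> complex.Re (v (p s1)).
    apply: cvg_Re; exact: (cvg_comp _ _ (@pc s1) (vc _)).
  exact: (h _ (lt_nbhsr v1)).
near=> s; have -> : L s = L s1 + clog (v (p s) / v (p s1)) by near: s; exact: vL.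
have s_1 : 0 < complex.Re (v (p s) / v (p s1)) by near: s; exact: h1.
have s_2 : 0 < complex.Re (v (p s)) by near: s.
have <- : clog (v (p s) / v (p s1)) + clog (v (p s1)) = clog (v (p s)).
  by rewrite -clogM ?divfK.
by ring.
Unshelve. all: by end_near. Qed.

Section ClassContinuation.
Variables (lambda : Cx R) (a a' : int) (b : 'rV[int]_n).
Variable L : Cx R -> 'rV[int]_n -> S -> Cx R.

Definition branch_sum s : Cx R :=
  \sum_(j < `|a|%N) \sum_(l < `|a'|%N) L (phase lambda a a' j l) b s.

(** The constant that turns the chosen branches into principal logarithms
    near [s0]. *)
Definition branch_shift s0 : Cx R :=
  \sum_(j < `|a|%N) \sum_(l < `|a'|%N)
    (clog (pole_factor (phase lambda a a' j l) b (p s0))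
       - L (phase lambda a a' j l) b s0).

(** Near the base point the shifted branches are principal logarithms, whose
    sum is [h]; everywhere else they are local branches, hence holomorphic. *)
Lemma continuation_class (k : Cx R) h s0 :
  (forall j l : nat, (j < `|a|)%N -> (l < `|a'|)%N ->
    log_branch (pole_factor (phase lambda a a' j l) b)
      (L (phase lambda a a' j l) b)) ->
  (forall j l : nat, (j < `|a|)%N -> (l < `|a'|)%N ->
    `|phase lambda a a' j l * qvar (p s0) b| < 1) ->
  (forall t, (forall j l : nat, (j < `|a|)%N -> (l < `|a'|)%N ->
      `|phase lambda a a' j l * qvar t b| < 1) ->
    h t = k * \sum_(j < `|a|%N) \sum_(l < `|a'|%N)
      clog (pole_factor (phase lambda a a' j l) b t)) ->
  continuation p s0 h (fun s => k * (branch_sum s + branch_shift s0)).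
Proof.
move=> Lb small hE; split.
  apply: holomorphic_overM; first exact: holomorphic_over_cst.
  apply: holomorphic_overD; last exact: holomorphic_over_cst.
  apply: holomorphic_over_sum => j _; apply: holomorphic_over_sum => l _.
  apply: (log_branch_holomorphic _ (Lb _ _ (ltn_ord j) (ltn_ord l))) => t.
  exact: pole_factor_differentiable.
have near1 : \forall s \near s0, forall (j : 'I_`|a|) (l : 'I_`|a'|),
    `|phase lambda a a' j l * qvar (p s) b| < 1.
  apply: filter_forall => j; apply: filter_forall => l.
  have := small j l (ltn_ord j) (ltn_ord l).
  rewrite modcE -/((1%:C)%C : Cx R) ltcR -subr_gt0 => m0.
  have h1 : phase lambda a a' j l * qvar (p s) b @[s --> s0] -->
      phase lambda a a' j l * qvar (p s0) b.
    have hq := differentiable_continuous (qvar_differentiable b (p s0)).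
    by apply: cvgMl_tmp; exact: (cvg_comp _ _ (@pc s0) hq).
  apply: filterS (near_modc (nbhs_filter s0) h1 m0) => s.
  rewrite ltrBrDr modcE -/((1%:C)%C : Cx R) ltcR; apply: le_lt_trans.
  by apply: le_trans (modcD _ _); rewrite subrK.
have near2 : \forall s \near s0, forall (j : 'I_`|a|) (l : 'I_`|a'|),
    L (phase lambda a a' j l) b s +
      (clog (pole_factor (phase lambda a a' j l) b (p s0))
       - L (phase lambda a a' j l) b s0) =
    clog (pole_factor (phase lambda a a' j l) b (p s)).
  apply: filter_forall => j; apply: filter_forall => l.
  apply: log_branch_near (Lb _ _ (ltn_ord j) (ltn_ord l)) _.
    exact: pole_factor_continuous.
  apply: Re_1B_gt0; rewrite -ltcR -modcE; exact: small.
near=> s; rewrite hE; last first.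
  have small_s : forall (j : 'I_`|a|) (l : 'I_`|a'|),
      `|phase lambda a a' j l * qvar (p s) b| < 1 by near: s.
  by move=> j l ja la; exact: (small_s (Ordinal ja) (Ordinal la)).
congr (_ * _); rewrite /branch_sum /branch_shift -big_split /=.
apply: eq_bigr => j _; rewrite -big_split /=; apply: eq_bigr => l _.
by move: j l; near: s.
Unshelve. all: by end_near. Qed.

End ClassContinuation.

End Continuation.

(** * The flop on classes and sums over the flopped ray *)

Section FlopData.
Variables (R : realType) (n : nat).
Implicit Types (Y : gv_threefold n) (b c C : 'rV[int]_n) (eta xi : 'cV[int]_n).

Lemma eff_neq0 Y C : eff Y C -> C != 0.
Proof.
move=> CE; have [A hA] := eff_ample Y.
by apply: contraTneq (hA _ CE) => ->; rewrite /pairing mul0mx mxE ltxx.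
Qed.

Lemma mulrn_ray_inj Y C : eff Y C -> injective (fun d : nat => C *+ d).
Proof.
move=> CE d e; have [A hA] := eff_ample Y.
move=> /(congr1 (fun b => pairing b A)); rewrite !pairingMn.
rewrite -!(mulr_natr (pairing C A)).
by move/(mulfI (lt0r_neq0 (hA _ CE))) => /eqP; rewrite eqr_nat => /eqP.
Qed.

Definition gv_supp Y : seq 'rV[int]_n :=
  finmap.enum_fset (fset_set [set b | gv Y b != 0]).

Definition gv_ray Y C : set nat := [set d | (0 < d)%N /\ gv Y (C *+ d) != 0].

Lemma gv_ray_finite Y C : eff Y C -> finite_set (gv_ray Y C).
Proof.
move=> CE; apply: (@sub_finite_set _ _ ((fun d => C *+ d) @^-1` [set b | gv Y b != 0])).
  by move=> d [].
apply: finite_preimage; last exact: gv_finite.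
by move=> d e _ _; exact: mulrn_ray_inj CE d e.
Qed.

Lemma sum_eff_supp Y (f : 'rV[int]_n -> Cx R) :
  (forall b, gv Y b = 0 -> f b = 0) ->
  \sum_(b \in eff Y) f b = \sum_(b \in [set b | gv Y b != 0]) f b.
Proof.
move=> f0; apply/esym/fsbig_widen.
  by move=> b; exact: gv_eff.
by move=> b /= [_ /negP]; rewrite negbK => /eqP/f0.
Qed.

Lemma sum_ray Y C (f : 'rV[int]_n -> Cx R) : eff Y C ->
  (forall b, gv Y b = 0 -> f b = 0) ->
  \sum_(b \in [set b | gv Y b != 0] `&` ray C) f b =
  \sum_(d \in [set d : nat | (0 < d)%N]) f (C *+ d).
Proof.
move=> CE f0; transitivity (\sum_(d \in gv_ray Y C) f (C *+ d)).
  apply: (@reindex_fsbig _ _ _ _ _ (fun d => C *+ d)); split.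
  - by move=> d [d0 gd]; split => //; exists d.
  - by move=> d e _ _; exact: mulrn_ray_inj CE d e.
  - by move=> b [/= gb [d d0 bd]]; exists d => //; split => //; rewrite -bd.
apply: fsbig_widen; first by move=> d [].
by move=> d /= [d0 /not_andP[//|/negP]]; rewrite negbK => /eqP/f0.
Qed.

Lemma sum_gv_ray Y C (f : nat -> Cx R) :
  (forall d, (0 < d)%N -> gv Y (C *+ d) = 0 -> f d = 0) -> eff Y C ->
  \sum_(d \in [set d : nat | (0 < d)%N]) f d =
  \sum_(d <- finmap.enum_fset (fset_set (gv_ray Y C))) f d.
Proof.
move=> f0 CE; rewrite -fsbig_finite; last exact: gv_ray_finite.
apply/esym/fsbig_widen; first by move=> d [].
by move=> d /= [d0 /not_andP[//|/negP]]; rewrite negbK => /eqP/f0; exact.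
Qed.

Lemma kappaE Y C : eff Y C -> (kappa Y C)%:~R =
  \sum_(d <- finmap.enum_fset (fset_set (gv_ray Y C)))
    d%:R ^+ 3 * (gv Y (C *+ d))%:~R :> Cx R.
Proof.
move=> CE; rewrite /kappa.
rewrite (_ : \sum_(d \in _) _ =
    \sum_(d \in gv_ray Y C) (d ^ 3)%:Z * gv Y (C *+ d)); last first.
  apply/esym/fsbig_widen; first by move=> d [].
  move=> d /= [d0 /not_andP[//|/negP]]; rewrite negbK => /eqP ->.
  by rewrite mulr0.
rewrite fsbig_finite; last exact: gv_ray_finite.
rewrite rmorph_sum; apply: eq_bigr => d _.
by rewrite rmorphM /= -pmulrn natrX.
Qed.

Variables (X Xp : gv_threefold n) (phi : simple_flop X Xp).

Lemma cpairing_flop_coord (t : 'cV[Cx R]_n) c :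
  cpairing c (flop_coord phi t) = cpairing (c *m fM phi) t.
Proof. by rewrite /cpairing /flop_coord mulmxA map_mxM. Qed.

Lemma qvar_flop_coord (t : 'cV[Cx R]_n) c :
  qvar (flop_coord phi t) c = qvar t (c *m fM phi).
Proof. by rewrite /qvar cpairing_flop_coord. Qed.

Lemma logq_flop_coord (t : 'cV[Cx R]_n) c :
  logq (flop_coord phi t) c = logq t (c *m fM phi).
Proof. by rewrite /logq cpairing_flop_coord. Qed.

Lemma pairing_flopN c eta : pairing (c *m fM phi) (flopN phi eta) = pairing c eta.
Proof.
by rewrite /pairing /flopN mulmxA -[c *m _ *m _]mulmxA mulmxV ?mulmx1 ?fM_unit.
Qed.

Lemma ray_fM d : (fCp phi *+ d) *m fM phi = - (fC phi *+ d).
Proof. by rewrite -!scaler_nat -scalemxAl fM_curve scalerN. Qed.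

Lemma pairing_fC_flopN d eta :
  pairing (fC phi *+ d) (flopN phi eta) = - pairing (fCp phi *+ d) eta.
Proof. by rewrite -[in RHS]pairing_flopN ray_fM pairingNl opprK. Qed.

Lemma flop_off_bij :
  set_bij ([set c | gv Xp c != 0] `\` ray (fCp phi))
    ([set b | gv X b != 0] `\` ray (fC phi)) (mulmx^~ (fM phi)).
Proof.
split.
- move=> c [/= gc rc]; have [rb gb] := fgv_off gc rc.
  by split => //=; rewrite -gb.
- move=> c c' _ _ /= /(congr1 (mulmx^~ (invmx (fM phi)))).
  by rewrite /= -!mulmxA mulmxV ?fM_unit// !mulmx1.
- move=> b [/= gb rb]; have [c [gc rc cb]] := fgv_off_surj (s := phi) gb rb.
  by exists c.
Qed.

Lemma defect_form : exists D : 'M[int]_n,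
  (forall eta xi, (eta^T *m D *m xi) ord0 ord0 =
    kappa X (fC phi) * pairing (fCp phi) eta * pairing (fCp phi) xi) /\
  \rank (map_mx intr D : 'M[rat]_n) = (kappa X (fC phi) != 0) :> nat.
Proof.
set k := kappa X _; set Cp := fCp phi.
exists (k *: (Cp^T *m Cp)); split.
  move=> eta xi; rewrite -scalemxAr -scalemxAl mxE -mulrA; congr (_ * _).
  rewrite mulmxA -trmx_mul -mulmxA mxE big_ord1 /pairing; congr (_ * _).
  by rewrite mxE.
rewrite map_mxZ map_mxM -matrix.map_trmx /=.
have C0 : map_mx intr Cp != 0 :> 'rV[rat]_n.
  apply: contraTneq (eff_neq0 (fCp_eff phi)) => h; rewrite negbK.
  apply/eqP/matrixP => i j; have := congr1 (fun M : 'rV[rat]_n => M i j) h.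
  by rewrite !mxE => /eqP; rewrite intr_eq0 => /eqP.
have [->|k0] := eqVneq k 0; first by rewrite scale0r mxrank0.
rewrite mxrank_scale_nz ?intr_eq0// mxrankMfree ?mxrank_tr ?rank_rV ?C0//.
by rewrite /row_free rank_rV C0.
Qed.

End FlopData.

(** * Inversion of the Novikov variable on the ray *)

Section RayComparison.
Variables (R : realType) (n : nat) (S : topologicalType).
Variable p : S -> 'cV[Cx R]_n.
Hypothesis pc : continuous p.
Hypothesis Spc : path_connected R S.
Implicit Types (b : 'rV[int]_n) (s : S).

Lemma logq_continuous b : continuous (fun s => logq (p s) b).
Proof.
move=> s; apply: cvgMl_tmp.
have hq := differentiable_continuous (cpairing_differentiable b (p s)).
exact: (cvg_comp _ _ (@pc s) hq).
Qed.

(** [1 - z = - z (1 - z^-1)], so the two logarithms differ by [log z] up to a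
    constant. *)
Lemma log_branch_inv (ph : Cx R) b (L L' : S -> Cx R) : ph != 0 ->
  log_branch p (pole_factor ph b) L ->
  log_branch p (pole_factor ph^-1 (- b)) L' ->
  forall s s', L s - L' s - logq (p s) b = L s' - L' s' - logq (p s') b.
Proof.
move=> ph0 Lb L'b.
have Lc := log_branch_continuous pc (@pole_factor_continuous R n _ _) Lb.
have L'c := log_branch_continuous pc (@pole_factor_continuous R n _ _) L'b.
have [v0 [k Lk] _] := Lb; have [v'0 [k' L'k] _] := L'b.
apply: (cexp_cst_path_connected Spc (K := fun s => L s - L' s - logq (p s) b)).
  move=> s; apply: cvgB; last exact: logq_continuous.
  by apply: cvgB; [exact: Lc|exact: L'c].
suff cK s : cexp (L s - L' s - logq (p s) b) = - ph * k / k'.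
  by move=> s s'; rewrite !cK.
have k'0 : k' != 0.
  by apply: contraTneq (cexp_neq0 (L' s)) => e; rewrite L'k e mulr0 eqxx.
rewrite !cexpB Lk L'k -/(qvar (p s) b).
have q0 : qvar (p s) b != 0 by exact: cexp_neq0.
have := v'0 s; rewrite /pole_factor qvarN => w0.
have -> : 1 - ph * qvar (p s) b =
    - ph * qvar (p s) b * (1 - ph^-1 * (qvar (p s) b)^-1).
  by field; rewrite ph0 q0.
move: (1 - _) w0 => w w0; by field; rewrite k'0 q0 w0.
Qed.

(** The phases of a class are permuted by inversion, which is why a class on
    the ray and its opposite have the same poles. *)
Lemma phase_rev (lambda : Cx R) (a a' : int) (j : 'I_`|a|) (l : 'I_`|a'|) :
  phase lambda a a' (rev_ord j) (rev_ord l) = (phase lambda a a' j l)^-1.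
Proof.
rewrite -cexpN /phase; congr cexp; rewrite /= !natrD !natrB//.
by rewrite -!natr1; field.
Qed.

Lemma phaseN (lambda : Cx R) (a a' : int) j l :
  phase lambda (- a) (- a') j l = phase lambda a a' j l.
Proof. by rewrite /phase !abszN. Qed.

(** Each phase is matched with its inverse; every one of the [|a| |a'|] pairs
    contributes one logarithm of the Novikov variable. *)
Lemma branch_sum_ray (lambda : Cx R) (a a' : int) b
    (L : Cx R -> 'rV[int]_n -> S -> Cx R) :
  (forall j l : nat, (j < `|a|)%N -> (l < `|a'|)%N ->
    log_branch p (pole_factor (phase lambda a a' j l) b)
      (L (phase lambda a a' j l) b)) ->
  (forall j l : nat, (j < `|a|)%N -> (l < `|a'|)%N ->
    log_branch p (pole_factor (phase lambda a a' j l) (- b))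
      (L (phase lambda a a' j l) (- b))) ->
  forall s s',
    branch_sum lambda a a' b L s - branch_sum lambda (- a) (- a') (- b) L s
      - (`|a| * `|a'|)%N%:R * logq (p s) b =
    branch_sum lambda a a' b L s' - branch_sum lambda (- a) (- a') (- b) L s'
      - (`|a| * `|a'|)%N%:R * logq (p s') b.
Proof.
move=> Lb LNb.
suff sumE s : branch_sum lambda a a' b L s
      - branch_sum lambda (- a) (- a') (- b) L s
      - (`|a| * `|a'|)%N%:R * logq (p s) b =
    \sum_(j < `|a|%N) \sum_(l < `|a'|%N) (L (phase lambda a a' j l) b s
      - L (phase lambda a a' j l)^-1 (- b) s - logq (p s) b).
  move=> s s'; rewrite !sumE; apply: eq_bigr => j _; apply: eq_bigr => l _.
  have ph0 : phase lambda a a' j l != 0 by rewrite /phase cexp_neq0.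
  have := LNb _ _ (ltn_ord (rev_ord j)) (ltn_ord (rev_ord l)).
  rewrite phase_rev => LNjl.
  exact: (log_branch_inv ph0 (Lb _ _ (ltn_ord j) (ltn_ord l)) LNjl).
have -> : branch_sum lambda (- a) (- a') (- b) L s =
    \sum_(j < `|a|%N) \sum_(l < `|a'|%N) L (phase lambda a a' j l)^-1 (- b) s.
  rewrite /branch_sum !abszN (reindex_inj rev_ord_inj); apply: eq_bigr => j _.
  rewrite (reindex_inj rev_ord_inj); apply: eq_bigr => l _.
  by rewrite phaseN phase_rev.
have -> : (`|a| * `|a'|)%N%:R * logq (p s) b =
    \sum_(j < `|a|%N) \sum_(l < `|a'|%N) logq (p s) b.
  by rewrite !sumr_const !card_ord -mulrnA mulnC mulr_natl.
rewrite /branch_sum -!sumrB; apply: eq_bigr => j _; rewrite -!sumrB.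
by apply: eq_bigr => l _.
Qed.

End RayComparison.

(** * Flop transformation of the forcing *)

Theorem theorem1p3 (R : realType) (n : nat) (X Xp : gv_threefold n)
    (phi : simple_flop X Xp) :
  let C := fC phi in
  let Cp := fCp phi in
  let M := fM phi in
  let N := flopN phi in
  let kap := kappa X C in
  (* the defect form: it does not involve lambda and has rank one *)
  exists D : 'M[int]_n,
  [/\ forall eta xi : 'cV[int]_n,
        (eta^T *m D *m xi) ord0 ord0 = kap * pairing Cp eta * pairing Cp xi,
      \rank (map_mx intr D : 'M[rat]_n) = (kap != 0) :> nat &
  forall (lambda : Cx R) (eta xi : 'cV[int]_n)
    (S : topologicalType) (p : S -> 'cV[Cx R]_n) (s0 sp : S),
  generic lambda ->
  simply_connected R S ->
  covering p (flop_complement phi lambda eta xi) ->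
  large_volume X lambda (N eta) (N xi) (p s0) ->
  large_volume Xp lambda eta xi (flop_coord phi (p sp)) ->
  let logr := fun s => logq (flop_coord phi (p s)) Cp in
  let defect := fun s =>
    kap%:~R * (pairing Cp eta)%:~R * (pairing Cp xi)%:~R * logr s in
  exists (f g : S -> Cx R) (F G : 'rV[int]_n -> S -> Cx R),
  (* f and g continue the forcings of X and X+, and F and G the contributions
     of the single classes *)
  [/\ [/\ continuation p s0 (forcing X lambda (N eta) (N xi)) f,
          continuation p sp (forcing Xp lambda eta xi \o flop_coord phi) g,
          forall b, continuation p s0
            (class_forcing X lambda (N eta) (N xi) b) (F b) &
          forall c, continuation p sp
            (class_forcing Xp lambda eta xi c \o flop_coord phi) (G c)],
      (forall s, f s = \sum_(b \in eff X) F b s) /\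
      (forall s, g s = \sum_(c \in eff Xp) G c s),
      (* flop transformation *)
      novikov_equiv (fun s => g s - f s) defect,
      (* support on the flopped ray *)
      (forall c, gv Xp c != 0 -> ~ ray Cp c ->
        novikov_equiv (G c) (F (c *m M))) /\
      novikov_equiv
        (fun s => \sum_(d \in [set d : nat | (0 < d)%N]) G (Cp *+ d) s
                  - \sum_(d \in [set d : nat | (0 < d)%N]) F (C *+ d) s)
        defect &
      (* covariance of the renormalized forcings *)
      novikov_equiv
        (fun s => renormalize kap Cp eta xi (flop_coord phi (p s)) (g s))
        (fun s => renormalize kap C (N eta) (N xi) (p s) (f s))]].
Proof.
move=> C Cp M N kap; have [D [DE Drank]] := defect_form phi.
exists D; split => // lambda eta xi S p s0 sp gen sc cov lvX lvXp logr defect.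
have [pc pU _] := cov.
have CE : eff X C := fC_eff phi.
have CpE : eff Xp Cp := fCp_eff phi.
have inU s : flop_complement phi lambda eta xi (p s).
  by rewrite -pU; exists s.
(* Both continuations use the same branches, with constants adjusted at s0
   and at sp; for a factor with zeros the value of the branch is irrelevant,
   since it is only used with coefficient zero. *)
have logs (q : Cx R * 'rV[int]_n) : exists L : S -> Cx R,
    (forall s, pole_factor q.1 q.2 (p s) != 0) ->
    log_branch p (pole_factor q.1 q.2) L.
  have [v0|nv0] := pselect (forall s, pole_factor q.1 q.2 (p s) != 0); last first.
    by exists (fun=> 0) => /nv0.
  have [L [L1 L2]] :=
    log_lift s0 sc cov (@pole_factor_continuous R n q.1 q.2) v0.
  by exists L => _; split => //; exists (pole_factor q.1 q.2 (p s0))^-1.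
have [L0 hL0] := choice logs.
pose L ph b := L0 (ph, b).
have LX b : gv X b != 0 -> forall j l : nat,
    (j < `|pairing b (N eta)|)%N -> (l < `|pairing b (N xi)|)%N ->
    log_branch p (pole_factor (phase lambda (pairing b (N eta)) (pairing b (N xi)) j l) b)
      (L (phase lambda (pairing b (N eta)) (pairing b (N xi)) j l) b).
  move=> gb j l ja la; apply: (hL0 (_, b)) => s /=.
  rewrite /pole_factor subr_eq0; apply/negP => /eqP e.
  by apply: (inU s); left; exists b; split => //; exists j, l; split.
have LXp c : gv Xp c != 0 -> forall j l : nat,
    (j < `|pairing c eta|)%N -> (l < `|pairing c xi|)%N ->
    log_branch p (pole_factor (phase lambda (pairing c eta) (pairing c xi) j l) (c *m M))
      (L (phase lambda (pairing c eta) (pairing c xi) j l) (c *m M)).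
  move=> gc j l ja la; apply: (hL0 (_, c *m M)) => s /=.
  rewrite /pole_factor subr_eq0; apply/negP => /eqP e.
  apply: (inU s); right; exists c; split => //; exists j, l; split => //.
  by rewrite qvar_flop_coord -/M -e.
pose shift a a' b s := branch_shift p lambda a a' b L s.
pose F b s := forcing_coef R X (N eta) (N xi) b *
  (branch_sum lambda (pairing b (N eta)) (pairing b (N xi)) b L s +
   shift (pairing b (N eta)) (pairing b (N xi)) b s0).
pose G c s := forcing_coef R Xp eta xi c *
  (branch_sum lambda (pairing c eta) (pairing c xi) (c *m M) L s +
   shift (pairing c eta) (pairing c xi) (c *m M) sp).
have F0 b s : gv X b = 0 -> F b s = 0.
  by move=> b0; rewrite /F /forcing_coef b0 !mul0r.
have G0 c s : gv Xp c = 0 -> G c s = 0.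
  by move=> c0; rewrite /G /forcing_coef c0 !mul0r.
have contF b : continuation p s0 (class_forcing X lambda (N eta) (N xi) b) (F b).
  have [b0|b0] := eqVneq (gv X b) 0.
    split; last by near=> s; rewrite class_forcing0// F0.
    rewrite (_ : F b = fun=> 0); first exact: holomorphic_over_cst.
    by apply/funext => s; rewrite F0.
  apply: continuation_class => //; [exact: LX|exact: lvX|].
  by move=> t small; exact: class_forcingE.
have contG c : continuation p sp
    (class_forcing Xp lambda eta xi c \o flop_coord phi) (G c).
  have [c0|c0] := eqVneq (gv Xp c) 0.
    split; last by near=> s; rewrite /= class_forcing0// G0.
    rewrite (_ : G c = fun=> 0); first exact: holomorphic_over_cst.
    by apply/funext => s; rewrite G0.
  apply: continuation_class => //; first exact: LXp.
    by move=> j l ja la; rewrite -qvar_flop_coord; exact: lvXp.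
  move=> t small; rewrite /= class_forcingE//.
    congr (_ * _); apply: eq_bigr => j _; apply: eq_bigr => l _.
    by rewrite /pole_factor qvar_flop_coord.
  by move=> j l ja la; rewrite qvar_flop_coord; exact: small.
pose f s := \sum_(b \in eff X) F b s.
pose g s := \sum_(c \in eff Xp) G c s.
have seqX (h : 'rV[int]_n -> Cx R) : (forall b, gv X b = 0 -> h b = 0) ->
    \sum_(b \in eff X) h b = \sum_(b <- gv_supp X) h b.
  by move=> h0; rewrite sum_eff_supp// fsbig_finite//; exact: gv_finite.
have seqXp (h : 'rV[int]_n -> Cx R) : (forall b, gv Xp b = 0 -> h b = 0) ->
    \sum_(b \in eff Xp) h b = \sum_(b <- gv_supp Xp) h b.
  by move=> h0; rewrite sum_eff_supp// fsbig_finite//; exact: gv_finite.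
have contf : continuation p s0 (forcing X lambda (N eta) (N xi)) f.
  have -> : f = fun s => \sum_(b <- gv_supp X) F b s.
    by apply/funext => s; apply: seqX => b b0; exact: F0.
  have -> : forcing X lambda (N eta) (N xi) = fun t => \sum_(b <- gv_supp X)
      class_forcing X lambda (N eta) (N xi) b t.
    by apply/funext => t; apply: seqX => b b0; exact: class_forcing0.
  by apply: continuation_sum => b _; exact: contF.
have contg : continuation p sp (forcing Xp lambda eta xi \o flop_coord phi) g.
  have -> : g = fun s => \sum_(c <- gv_supp Xp) G c s.
    by apply/funext => s; apply: seqXp => c c0; exact: G0.
  have -> : forcing Xp lambda eta xi \o flop_coord phi =
      fun t => \sum_(c <- gv_supp Xp)
        (class_forcing Xp lambda eta xi c \o flop_coord phi) t.
    by apply/funext => t; apply: seqXp => c c0; exact: class_forcing0.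
  by apply: continuation_sum => c _; exact: contG.
(* The pairings, the phases and q^(c M) = r^c are preserved, so the same
   branches occur on both sides. *)
have off c : gv Xp c != 0 -> ~ ray Cp c -> forall s s',
    G c s - F (c *m M) s = G c s' - F (c *m M) s'.
  move=> gc rc s s'; have [_ gE] := fgv_off gc rc.
  have cE : forcing_coef R X (N eta) (N xi) (c *m M) = forcing_coef R Xp eta xi c.
    by rewrite /forcing_coef !pairing_flopN gE.
  have alg (k x y u v : Cx R) :
    k * (x + u) - k * (x + v) = k * (y + u) - k * (y + v) by ring.
  by rewrite /G /F cE !pairing_flopN; exact: alg.
(* M sends d Cp to - d C, so the class inverts its Novikov variable and its
   pairings: |a| |a'| logarithms of r^d with coefficient n sgn a sgn a' give
   n d^3 (Cp . eta) (Cp . xi) log r. *)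
have on d : (0 < d)%N -> forall s s',
    G (Cp *+ d) s - F (C *+ d) s - d%:R ^+ 3 * (gv X (C *+ d))%:~R *
      (pairing Cp eta)%:~R * (pairing Cp xi)%:~R * logr s =
    G (Cp *+ d) s' - F (C *+ d) s' - d%:R ^+ 3 * (gv X (C *+ d))%:~R *
      (pairing Cp eta)%:~R * (pairing Cp xi)%:~R * logr s'.
  move=> d0 s s'; have gE : gv Xp (Cp *+ d) = gv X (C *+ d) := fgv_ray phi d0.
  have [g0|g0] := eqVneq (gv X (C *+ d)) 0.
    have Gd0 u : G (Cp *+ d) u = 0 by apply: G0; rewrite gE.
    have Fd0 u : F (C *+ d) u = 0 by exact: F0.
    have z (x y r : Cx R) : d%:R ^+ 3 * 0%:~R * x * y * r = 0.
      by rewrite mulr0z mulr0 !mul0r.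
    by rewrite g0 (Gd0 s) (Gd0 s') (Fd0 s) (Fd0 s') !z.
  have gp0 : gv Xp (Cp *+ d) != 0 by rewrite gE.
  have bE : (Cp *+ d) *m M = - (C *+ d) by exact: ray_fM.
  have aE y : pairing (C *+ d) (N y) = - pairing (Cp *+ d) y.
    exact: pairing_fC_flopN.
  have := LX _ g0; have := LXp _ gp0; rewrite /G /F /forcing_coef !aE bE gE.
  set a := pairing (Cp *+ d) eta; set a' := pairing (Cp *+ d) xi.
  rewrite !sgzN !abszN => Lb LNb.
  have {}LNb (j l : nat) : (j < `|a|)%N -> (l < `|a'|)%N ->
      log_branch p (pole_factor (phase lambda a a' j l) (- - (C *+ d)))
      (L (phase lambda a a' j l) (- - (C *+ d))).
    by move=> ja la; have := LNb j l ja la; rewrite phaseN opprK.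
  have h := branch_sum_ray pc sc.1 Lb LNb s s'; rewrite opprK in h.
  have logrE u : logq (p u) (- (C *+ d)) = d%:R * logr u.
    by rewrite -bE -logq_flop_coord /logr /logq cpairingMn mulrCA.
  move: h; rewrite !logrE natrM !rmorphN /= mulrNN.
  have Kd : d%:R ^+ 3 * (gv X (C *+ d))%:~R * (pairing Cp eta)%:~R *
      (pairing Cp xi)%:~R = (gv X (C *+ d))%:~R *
      ((sgz a)%:~R * (sgz a')%:~R) * (`|a|%N%:R * `|a'|%N%:R * d%:R) :> Cx R.
    transitivity ((gv X (C *+ d))%:~R * (a%:~R * a'%:~R * d%:R) : Cx R).
      rewrite /a /a' !pairingMn !rmorphMn /=.
      rewrite -(mulr_natr (pairing Cp eta)%:~R) -(mulr_natr (pairing Cp xi)%:~R).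
      by ring.
    by rewrite (sgz_abs _ a) (sgz_abs _ a'); ring.
  rewrite Kd; move: (_ * (_%:~R * _%:~R)) => k.
  move: (_%:R * _%:R) => A.
  have alg (x y u v r : Cx R) : k * (x + u) - k * (y + v) - k * (A * d%:R) * r =
    k * (x - y - A * (d%:R * r)) + k * (u - v) by ring.
  by move=> h; rewrite !alg h.
clearbody F G.
have onray s s' :
    \sum_(d \in [set d : nat | (0 < d)%N]) G (Cp *+ d) s
      - \sum_(d \in [set d : nat | (0 < d)%N]) F (C *+ d) s - defect s =
    \sum_(d \in [set d : nat | (0 < d)%N]) G (Cp *+ d) s'
      - \sum_(d \in [set d : nat | (0 < d)%N]) F (C *+ d) s' - defect s'.
  have rE u : \sum_(d \in [set d : nat | (0 < d)%N]) G (Cp *+ d) u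
      - \sum_(d \in [set d : nat | (0 < d)%N]) F (C *+ d) u - defect u =
      \sum_(d <- finmap.enum_fset (fset_set (gv_ray X C)))
        (G (Cp *+ d) u - F (C *+ d) u - d%:R ^+ 3 * (gv X (C *+ d))%:~R *
      (pairing Cp eta)%:~R * (pairing Cp xi)%:~R * logr u).
    rewrite !sumrB /defect kappaE// !mulr_suml.
    rewrite (@sum_gv_ray _ _ X C)//; last first.
      by move=> d d0 g0; apply: G0; rewrite fgv_ray.
    by rewrite (@sum_gv_ray _ _ X C)// => d d0 g0; exact: F0.
  rewrite !rE; apply: eq_big_seq => d.
  rewrite in_fset_set; last exact: gv_ray_finite.
  by rewrite inE => -[d0 _]; exact: on.
have total s s' : g s - f s - defect s = g s' - f s' - defect s'.
  have gE u : g u = \sum_(d \in [set d : nat | (0 < d)%N]) G (Cp *+ d) u +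
      \sum_(c \in [set c | gv Xp c != 0] `\` ray Cp) G c u.
    rewrite /g sum_eff_supp; last by move=> c; exact: G0.
    rewrite (fsbigID (ray Cp)); last exact: gv_finite.
    by rewrite sum_ray// => c; exact: G0.
  have fE u : f u = \sum_(d \in [set d : nat | (0 < d)%N]) F (C *+ d) u +
      \sum_(c \in [set c | gv Xp c != 0] `\` ray Cp) F (c *m M) u.
    rewrite /f sum_eff_supp; last by move=> b; exact: F0.
    rewrite (fsbigID (ray C)); last exact: gv_finite.
    rewrite sum_ray//; last by move=> b; exact: F0.
    by congr (_ + _); exact: (reindex_fsbig _ _ _ _ (flop_off_bij phi)).
  have offE : \sum_(c \in [set c | gv Xp c != 0] `\` ray Cp) G c s
      - \sum_(c \in [set c | gv Xp c != 0] `\` ray Cp) F (c *m M) s =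
      \sum_(c \in [set c | gv Xp c != 0] `\` ray Cp) G c s'
      - \sum_(c \in [set c | gv Xp c != 0] `\` ray Cp) F (c *m M) s'.
    have fin : finite_set ([set c | gv Xp c != 0] `\` ray Cp).
      by apply: finite_setD; exact: gv_finite.
    rewrite !fsbig_finite// -!sumrB; apply: eq_big_seq => c.
    by rewrite in_fset_set// inE => -[/= gc rc]; exact: off.
  have alg (x y z u v : Cx R) : x + u - (y + v) - z = x - y - z + (u - v).
    by ring.
  by rewrite (gE s) (gE s') (fE s) (fE s') alg [RHS]alg (onray s s') offE.
exists f, g, F, G; split => //.
- by exists (g s0 - f s0 - defect s0) => s; exact: total.
- split.
    by move=> c gc rc; exists (G c s0 - F (c *m M) s0) => s; exact: off.
  eexists => s; exact: (onray s s0).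
- exists (g s0 - f s0 - defect s0) => s; rewrite -(total s s0) /renormalize.
  have -> : pairing C (N eta) = - pairing Cp eta.
    by have := pairing_fC_flopN phi 1 eta.
  have -> : pairing C (N xi) = - pairing Cp xi.
    by have := pairing_fC_flopN phi 1 xi.
  have -> : logq (p s) C = - logr s.
    rewrite /logr logq_flop_coord fM_curve /logq cpairingN mulrN opprK.
    by [].
  by rewrite /defect -/(logr s) !rmorphN /=; field.
Unshelve. all: by end_near. Qed.
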